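(* There is a universal constant $C$ such that the following holds. Let $n\ge 8$ and $p\ge 8$ be integers, let $X$ be a nonzero real $n\times p$ matrix, let $\beta_0\in\mathbb{R}^p$ and $\sigma>0$, and let $Y=X\beta_0+\varepsilon$, where $\varepsilon\sim N_n(0,\sigma^2 I_n)$. Let $\gamma$, $\hat\sigma$ and $\hat\beta$ be obtained from $X$ and $Y$ by the procedure described in the context. Let \[ r := \frac{|\beta_0|_1\gamma}{\sigma}\sqrt{\frac{\log(p+n)}{n}}. \] Then \[ \frac{\mathbb{E}\|X\hat\beta-X\beta_0\|^2}{n\sigma^2}\le Cr+Cr^2+C\sqrt{\frac{\log(p+n)}{n}}+\frac{C\log(p+n)}{n} \] and \[ \mathbb{E}\biggl(\frac{\hat\sigma}{\sigma}-1\biggr)^2\le Cr^2+\frac{C\log(p+n)}{n}. \]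
   Context: $\|\cdot\|$ is the Euclidean norm, $|\cdot|_1$ is the $\ell^1$ norm, $I_n$ is the $n\times n$ identity matrix, and $N_n(\mu,\Sigma)$ is the $n$-dimensional Gaussian distribution with mean $\mu$ and covariance $\Sigma$. Procedure producing $\hat\sigma$ and $\hat\beta$ from $(X,Y)$: 1. Let $\gamma:=\max_{1\le j\le p}\|X_j\|/\sqrt{n}$, where $X_j$ is the $j$th column of $X$. 2. Let $\widetilde X := [X\ \ \sqrt{n}\,\gamma I_n]$, a matrix of order $n\times(p+n)$. 3. Generate $Z\sim N_n(0,I_n)$ independent of $Y$. 4. Let $M_1:=\min\{|\beta|_1:\beta\in\mathbb{R}^{p+n},\ Y=\widetilde X\beta\}$ and $M_2:=\min\{|\beta|_1:\beta\in\mathbb{R}^{p+n},\ Z=\widetilde X\beta\}$. 5. Let $\hat\sigma:=M_1/M_2$. 6. Let $Y'$ be the (Euclidean) projection of $Y$ onto the column space of $X$. 7. Let $\hat\beta:=\operatorname{argmin}\{|\beta|_1:\beta\in\mathbb{R}^p,\ \|Y'-X\beta\|^2\le k\hat\sigma^2\}$, where $k$ is the rank of $X$. *)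

(* Defs.v *)
From HB Require Import structures.
From mathcomp Require Import all_boot all_order all_algebra.
From mathcomp Require Import all_classical all_reals all_analysis.

Set Implicit Arguments.
Unset Strict Implicit.
Unset Printing Implicit Defensive.

Import Order.TTheory GRing.Theory Num.Theory.
Import numFieldNormedType.Exports.

Local Open Scope classical_set_scope.
Local Open Scope ring_scope.

(* The norm [`|v|] that the library puts on matrices is the sup norm, hence
   the explicit norms below. *)
Definition l2norm {R : realType} {m : nat} (v : 'cV[R]_m) : R :=
  Num.sqrt (\sum_(i < m) v i ord0 ^+ 2).

Definition l1norm {R : realType} {m : nat} (v : 'cV[R]_m) : R :=
  \sum_(i < m) `|v i ord0|.

Definition component {R : realType} {T : Type} {m : nat} (V : T -> 'cV[R]_m)
  (i : 'I_m) : T -> R := fun w => V w i ord0.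

(* [V] has law N_m(0, s^2 I_m), i.e. the m-fold product of N(0, s^2); a law on
   R^m is determined by its values on measurable boxes.  The parameter [s] of
   [normal_prob] is the standard deviation. *)
Definition isotropic_gaussian {d : measure_display} {Omega : measurableType d}
    {R : realType} (P : probability Omega R) {m : nat} (s : R)
    (V : Omega -> 'cV[R]_m) : Prop :=
  (forall i, measurable_fun [set: Omega] (component V i)) /\
  (forall B : 'I_m -> set R, (forall i, measurable (B i)) ->
     P [set w | forall i, B i (component V i w)]
     = (\prod_(i < m) normal_prob 0 s (B i))%E).

(* [g_sigma_preimage (component U)] is the sigma-algebra on [Omega] generated by
   the random vector [U]. *)
Definition independent_vectors {d : measure_display}
    {Omega : measurableType d} {R : realType} (P : probability Omega R)
    {m1 m2 : nat} (U : Omega -> 'cV[R]_m1) (V : Omega -> 'cV[R]_m2) : Prop :=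
  forall A B : set Omega,
    g_sigma_preimage (component U) A -> g_sigma_preimage (component V) B ->
    P (A `&` B) = (P A * P B)%E.

Definition is_min {R : realType} (S : set R) (m : R) : Prop :=
  S m /\ lbound S m.

Definition is_argmin {R : realType} {T : Type} (f : T -> R) (S : set T)
    (x : T) : Prop :=
  S x /\ forall y, S y -> f x <= f y.

(* The default value 0 of the maximum is harmless: the terms are nonnegative. *)
Definition gamma {R : realType} {n p : nat} (X : 'M[R]_(n, p)) : R :=
  \big[Num.max/0]_(j < p) (l2norm (col j X) / Num.sqrt n%:R).

Definition Xtilde {R : realType} {n p : nat} (X : 'M[R]_(n, p)) :
    'M[R]_(n, p + n) :=
  row_mx X ((Num.sqrt n%:R * gamma X) *: 1%:M).

Definition is_min_l1 {R : realType} {n q : nat} (A : 'M[R]_(n, q))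
    (y : 'cV[R]_n) (M : R) : Prop :=
  is_min [set l1norm b | b in [set b : 'cV[R]_q | y = A *m b]] M.

Definition is_sigma_hat {R : realType} {n p : nat} (X : 'M[R]_(n, p))
    (y z : 'cV[R]_n) (s : R) : Prop :=
  exists M1 M2 : R,
    [/\ is_min_l1 (Xtilde X) y M1, is_min_l1 (Xtilde X) z M2 & s = M1 / M2].

Definition is_projection {R : realType} {n p : nat} (X : 'M[R]_(n, p))
    (y y' : 'cV[R]_n) : Prop :=
  is_argmin (fun u => l2norm (y - u)) (range (fun b : 'cV[R]_p => X *m b)) y'.

(* The minimizer need not be unique, so this is a relation: it accepts every
   choice of the argmin. *)
Definition is_beta_hat {R : realType} {n p : nat} (X : 'M[R]_(n, p))
    (y : 'cV[R]_n) (s : R) (b : 'cV[R]_p) : Prop :=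
  exists y' : 'cV[R]_n, is_projection X y y' /\
    is_argmin (@l1norm R p)
      [set b' | l2norm (y' - X *m b') ^+ 2 <= (\rank X)%:R * s ^+ 2] b.

(* Main.v *)
Require Import Defs.
From HB Require Import structures.
From mathcomp Require Import all_boot all_order all_algebra.
From mathcomp Require Import all_classical all_reals all_analysis.
From mathcomp Require Import measurable_realfun.
From mathcomp Require Import ring lra.

Set Implicit Arguments.
Unset Strict Implicit.
Unset Printing Implicit Defensive.

Import Order.TTheory GRing.Theory Num.Theory.
Import numFieldNormedType.Exports.

Local Open Scope classical_set_scope.
Local Open Scope ring_scope.

(* Let f be the norm whose unit ball is the convex hull of the columns of
   [Xtilde X] and their opposites, so that M_1 = f(Y) and M_2 = f(Z).  Then
   |f(Y) - f(eps)| <= |beta_0|_1, and f is 1/(sqrt n gamma)-Lipschitz in each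
   coordinate.  Hence gamma f of a standard Gaussian vector concentrates, with
   exponential moments of order one, around a center which is the same for
   eps / sigma and for Z; so sigmahat / sigma - 1 is small once f(Z) is bounded
   below.  For this, |z|^2 <= f(z) max_j |<a_j, z>| over the columns a_j; the
   maximum is of order gamma sqrt(n log(p + n)) by a union bound, and |z|^2 of
   order n is lost only where the product of the |z_i|^(-1/2), which is
   integrable, is exponentially large (n >= 8 controls the fourth power of
   1/f(Z) there).

   For the prediction error, minimality of the l^1 norm and convexity give
   |X betahat - X beta_0|^2 <=
     |k sigmahat^2 - |Pi eps|^2| + 4 |beta_0|_1 max_j |<X_j, eps>|,
   where Pi is the projection onto the column space of X and |Pi eps|^2 has
   variance of order k sigma^4.

   All the random quantities above are bounded by one variable, [error_total],
   whose mean is bounded by a universal constant. *)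

(** * Gaussian integrals *)

(** Since [betahat] is an arbitrary choice of minimizer, the errors need not be measurable; each is
    bounded pointwise by a constant times a measurable majorant. Products of random quantities, such
    as a squared deviation over f(Z)^2, are split by AM-GM into sums of fourth powers, so that the
    majorant is a sum whose mean is found term by term. Concentration compares f at two independent
    copies, which requires no mean or median beforehand: with Lipschitz constant c in each
    coordinate, every coordinate costs a factor exp(c^2), and c = n^(-1/2) after multiplication by
    gamma, so the total is e. The center is then the value of f at a point found by averaging. The
    obstacle is the inverse moment of f(Z) when |z| is small. If |z|^2 < n / 36^4, AM-GM makes the
    product of the |z_i|^(-1/2) exceed 36^n; of this, 9^n is spent on normalising the mean of that
    product and 4^n on absorbing powers of n. *)

Section one_dimensional_gaussian.
Context {R : realType}.
Local Notation mu := (@lebesgue_measure R).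
Implicit Types (m s : R) (f : R -> \bar R).

(** The Radon-Nikodym derivative agrees almost everywhere with [normal_pdf], because both have the
    same integral over every measurable set. *)
Lemma ge0_integral_normal_prob m s f :
  measurable_fun [set: R] f -> (forall x, 0 <= f x)%E ->
  (\int[normal_prob m s]_x f x = \int[mu]_x (f x * (normal_pdf m s x)%:E))%E.
Proof.
move=> mf f0.
have dom := normal_prob_dominates m s.
rewrite -(Radon_Nikodym_SigmaFinite.change_of_variables dom)//.
have mpdf : measurable_fun [set: R] (fun x => (normal_pdf m s x)%:E).
  by apply/measurable_EFinP; exact: measurable_normal_pdf.
have RNint := Radon_Nikodym_SigmaFinite.f_integrable dom.
apply: ae_eq_integral => //.
- by apply: emeasurable_funM => //; exact: measurable_int RNint.
- exact: emeasurable_funM.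
- apply: ae_eqe_mul2l.
  apply: integral_ae_eq => //= E _ mE.
  by rewrite -Radon_Nikodym_SigmaFinite.f_integral.
Qed.

(** Uniqueness of Lebesgue measure: the pushforward under division by [s], itself divided by [s],
    has the right value on half-open intervals. *)
Lemma lebesgue_measure_scale s (A : set R) : 0 < s -> measurable A ->
  mu [set t | A (t / s)] = (s%:E * mu A)%E.
Proof.
move=> s0 mA.
pose d (t : measurableTypeR R) : measurableTypeR R := t / s.
have md : measurable_fun setT d by exact: measurable_funM.
have k0 : 0 <= s^-1 by rewrite invr_ge0 ltW.
pose nu : {measure set _ -> \bar R} := mscale (NngNum k0) (pushforward mu d).
suff -> : mu A = nu md A.
  by rewrite /nu /= /mscale /pushforward/= muleA -EFinM divff ?gt_eqF// mul1e.
apply: (@lebesgue_measure_unique R (nu md) _ A mA) => _ [[a b]] _ <-.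
rewrite /nu /= /mscale /pushforward/=.
rewrite -[pushforward _ _ _]/(mu (d @^-1` _)) (_ : d @^-1` _ = `](s * a), (s * b)]%classic); last first.
  apply/seteqP; split=> x /=; rewrite !in_itv/= /d ltr_pdivlMr// ler_pdivrMr//;
    by rewrite ![_ * s]mulrC.
rewrite !lebesgue_measure_itv/= !lte_fin ltr_pM2l//; case: ifP; last by rewrite mule0.
by move=> _; rewrite -!EFinB -EFinM -mulrBr mulKf ?gt_eqF.
Qed.

Lemma normal_prob_scale s (B : set R) : 0 < s -> measurable B ->
  normal_prob 0 s [set t | B (t / s)] = normal_prob 0 1 B.
Proof.
move=> s0 mB; rewrite /normal_prob.
pose d (t : measurableTypeR R) : measurableTypeR R := t / s.
have md : measurable_fun setT d by exact: measurable_funM.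
have k0 := ltW s0.
have mpdf : measurable_fun B (fun x => (normal_pdf 0 1 x)%:E).
  by apply/measurable_EFinP/measurable_funTS; exact: measurable_normal_pdf.
transitivity (\int[pushforward mu d]_(x in B) (s^-1 * normal_pdf 0 1 x)%:E)%E.
  rewrite ge0_integral_pushforward//; last 2 first.
  - by apply/measurable_EFinP/measurable_funM => //; exact/measurable_EFinP.
  - by move=> x _; rewrite lee_fin mulr_ge0 ?invr_ge0 ?normal_pdf_ge0.
  apply: eq_integral => x _ /=; congr EFin.
  rewrite /d !normal_pdfE ?oner_neq0 ?gt_eqF//.
  rewrite /normal_peak /normal_fun !subr0 !mulrA; congr (_ * expR _).
    rewrite -mulrnAr expr1n mul1r sqrtrM ?sqr_ge0// sqrtr_sqr gtr0_norm// invfM.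
    by rewrite -mulr_natr.
  by rewrite expr1n exprMn exprVn mulNr -mulr_natr; field; lra.
transitivity (\int[mscale (NngNum k0) mu]_(x in B) (s^-1 * normal_pdf 0 1 x)%:E)%E.
  apply: eq_measure_integral => A mA AB.
  by rewrite /mscale/= /pushforward lebesgue_measure_scale.
rewrite ge0_integral_mscale//=; last 2 first.
  by apply/measurable_EFinP/measurable_funM => //; exact/measurable_EFinP.
  by move=> x _; rewrite lee_fin mulr_ge0 ?invr_ge0 ?normal_pdf_ge0.
under eq_integral do rewrite EFinM.
rewrite ge0_integralZl_EFin//; last by rewrite invr_ge0.
  by rewrite muleA -EFinM divff ?gt_eqF// mul1e.
by move=> x _; rewrite lee_fin normal_pdf_ge0.
Qed.

End one_dimensional_gaussian.

Section gaussian_moments.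
Context {R : realType}.
Local Notation mu := (@lebesgue_measure R).
Local Notation N := (@normal_prob R 0 1).

Lemma normal_mgf (c : R) :
  (\int[N]_t (expR (c * t))%:E = (expR (c ^+ 2 / 2))%:E)%E.
Proof.
rewrite ge0_integral_normal_prob//; last first.
  by apply/measurable_EFinP/measurableT_comp => //; exact: measurable_funM.
transitivity (\int[mu]_t ((expR (c ^+ 2 / 2))%:E * (normal_pdf c 1 t)%:E))%E.
  apply: eq_integral => t _; rewrite -!EFinM; congr EFin.
  rewrite !normal_pdfE ?oner_neq0// !(mulrCA _ (normal_peak 1)) /normal_fun -!expRD.
  by congr (_ * expR _); rewrite subr0 expr1n; field.
rewrite ge0_integralZl_EFin// ?expR_ge0//.
- by rewrite integral_normal_pdf mule1.
- by move=> x _; rewrite lee_fin normal_pdf_ge0.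
- by apply/measurable_EFinP; exact: measurable_normal_pdf.
Qed.

(** The tilted density is again Gaussian up to normalisation: it is 1/q times the density with
    standard deviation 1/q. *)
Lemma normal_chi2_mgf (a : R) : 2 * a < 1 ->
  (\int[N]_t (expR (a * t ^+ 2))%:E = (Num.sqrt (1 - 2 * a))^-1%:E)%E.
Proof.
move=> a1; set q := Num.sqrt _.
have q0 : 0 < q by rewrite sqrtr_gt0 subr_gt0.
have q2 : q ^+ 2 = 1 - 2 * a by rewrite sqr_sqrtr// subr_ge0 ltW.
rewrite ge0_integral_normal_prob//; last first.
  by apply/measurable_EFinP/measurableT_comp => //; apply: measurable_funM => //; exact: measurable_funX.
transitivity (\int[mu]_t (q^-1%:E * (normal_pdf 0 q^-1 t)%:E))%E.
  apply: eq_integral => t _; rewrite -!EFinM; congr EFin.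
  rewrite !normal_pdfE ?oner_neq0 ?invr_neq0 ?gt_eqF//.
  rewrite !(mulrCA _ (normal_peak _)) /normal_fun -expRD mulrA !subr0.
  congr (_ * expR _).
    rewrite /normal_peak -!mulrnAr expr1n mul1r sqrtrM ?sqr_ge0// sqrtr_sqr.
    by rewrite gtr0_norm ?invr_gt0// invfM invrK mulrC mulKf// gt_eqF.
  rewrite exprVn -[_ *+ 2]mulr_natr q2 expr1n.
  by field; apply/eqP; lra.
rewrite ge0_integralZl_EFin// ?invr_ge0 ?ltW//.
- by rewrite integral_normal_pdf mule1.
- by move=> x _; rewrite lee_fin normal_pdf_ge0.
- by apply/measurable_EFinP; exact: measurable_normal_pdf.
Qed.

Lemma normal_prob_sym (f : R -> \bar R) : measurable_fun [set: R] f ->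
  (forall x, 0 <= f x)%E -> (\int[N]_t f (- t)%R = \int[N]_t f t)%E.
Proof.
move=> mf f0.
have mN : measurable_fun [set: R] (-%R : R -> R) by [].
rewrite !ge0_integral_normal_prob//; last exact: measurableT_comp.
pose g t : \bar R := (f t * (normal_pdf 0 1 t)%:E)%E.
have mg : measurable_fun [set: R] g.
  by apply: emeasurable_funM => //; apply/measurable_EFinP; exact: measurable_normal_pdf.
transitivity (\int[mu]_x g (- x)%R)%E.
  apply: eq_integral => x _; rewrite /g; congr (_ * EFin _)%E.
  by rewrite !normal_pdfE ?oner_neq0// /normal_fun !subr0 sqrrN.
rewrite -[LHS](@ge0_integral_pushforward _ _ (measurableTypeR R) (measurableTypeR R) R -%R _ _ setT g)//.
- by apply: eq_measure_integral => //= A mA _; exact: lebesgue_measureN.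
- by move=> y _; rewrite mule_ge0// lee_fin normal_pdf_ge0.
Qed.

(** With y = t^2/4, exp(y) >= (1 + y/2)^2 >= y^2/4 gives the factor 64, and the chi-square transform
    at 1/4 is sqrt 2. *)
Lemma normal_moment4 : (\int[N]_t (t ^+ 4)%:E <= 256%:E)%E.
Proof.
have h (t : R) : t ^+ 4 <= 64 * expR (4^-1 * t ^+ 2).
  have := expR_ge1Dx ((4^-1 * t ^+ 2) / 2).
  set y := 4^-1 * t ^+ 2 => hy.
  have y0 : 0 <= y by rewrite mulr_ge0// sqr_ge0.
  have -> : t ^+ 4 = 16 * y ^+ 2 by rewrite /y; field.
  have -> : expR y = expR (y / 2) ^+ 2 by rewrite -expRM_natl; congr expR; field.
  nra.
apply: (@le_trans _ _ (\int[N]_t (64%:E * (expR (4^-1 * t ^+ 2))%:E)))%E.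
  apply: ge0_le_integral => //.
  - by move=> x _; rewrite lee_fin exprn_even_ge0.
  - by apply/measurable_EFinP; exact: measurable_funX.
  - apply: emeasurable_funM => //; apply/measurable_EFinP/measurableT_comp => //.
    by apply: measurable_funM => //; exact: measurable_funX.
  - by move=> x _; rewrite -EFinM lee_fin.
rewrite ge0_integralZl_EFin//; last first.
  apply/measurable_EFinP/measurableT_comp => //.
  by apply: measurable_funM => //; exact: measurable_funX.
rewrite normal_chi2_mgf; last lra.
rewrite -EFinM lee_fin.
set q := Num.sqrt _.
have q0 : 0 < q by rewrite sqrtr_gt0; lra.
have q2 : q ^+ 2 = 1 - 2 * 4^-1 by rewrite sqr_sqrtr//; lra.
rewrite ler_pdivrMr//; nra.
Qed.

Lemma integrable_normalX2 : N.-integrable setT (fun t => (t ^+ 2)%:E).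
Proof.
apply/integrableP; split; first by apply/measurable_EFinP; exact: measurable_funX.
apply: (@le_lt_trans _ _ (\int[N]_t (1 + (t ^+ 4)%:E)))%E.
  apply: ge0_le_integral => //.
  - apply/measurable_EFinP/measurableT_comp => //; exact: measurable_funX.
  - by apply: emeasurable_funD => //; apply/measurable_EFinP; exact: measurable_funX.
  - move=> x _; rewrite lee_fin ger0_norm ?sqr_ge0//.
    have -> : x ^+ 4 = (x ^+ 2) ^+ 2 by rewrite -exprM.
    have := sqr_ge0 x; nra.
rewrite ge0_integralD//; last 2 first.
  by move=> x _; rewrite lee_fin exprn_even_ge0.
  by apply/measurable_EFinP; exact: measurable_funX.
rewrite integral_cst//= probability_setT mule1.
by rewrite lte_add_pinfty ?ltry// (le_lt_trans normal_moment4)// ltry.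
Qed.

(** The moment is read off as the derivative at 0 of the chi-square transform, by inequalities
    alone. *)
Lemma normal_moment2 : (\int[N]_t (t ^+ 2)%:E = 1%:E)%E.
Proof.
have fi := integrable_fin_num measurableT integrable_normalX2.
rewrite -(fineK fi); congr EFin; set E := fine _.
have E0 : 0 <= E by apply: fine_ge0; apply: integral_ge0 => x _; rewrite lee_fin sqr_ge0.
have key (a : R) : 4 * a <= 1 -> 0 <= 1 + a * E -> (1 + a * E) ^+ 2 * (1 - 2 * a) <= 1.
  move=> a4 h0.
  have mexp : measurable_fun setT (fun t : R => (expR (a * t ^+ 2))%:E).
    apply/measurable_EFinP/measurableT_comp => //.
    by apply: measurable_funM => //; exact: measurable_funX.
  have iexp : N.-integrable setT (fun t => (expR (a * t ^+ 2))%:E).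
    apply/integrableP; split => //.
    under eq_integral do rewrite gee0_abs ?lee_fin ?expR_ge0//.
    by rewrite normal_chi2_mgf ?ltry//; lra.
  have : (\int[N]_t (1 + (a%:E * (t ^+ 2)%:E)) <= \int[N]_t (expR (a * t ^+ 2))%:E)%E.
    apply: le_integral => //.
      apply: integrableD => //; first exact: finite_measure_integrable_cst.
      by apply: integrableZl => //; exact: integrable_normalX2.
    by move=> t _; rewrite -EFinM -EFinD lee_fin expR_ge1Dx.
  rewrite integralD//; last 2 first.
    exact: finite_measure_integrable_cst.
    by apply: integrableZl => //; exact: integrable_normalX2.
  rewrite integral_cst//= probability_setT mule1 integralZl//; last exact: integrable_normalX2.
  rewrite -(fineK fi) -/E normal_chi2_mgf; last lra.
  rewrite -EFinM -EFinD lee_fin.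
  set q := Num.sqrt _ => hq.
  have q0 : 0 < q by rewrite sqrtr_gt0; lra.
  have <- : q ^+ 2 = 1 - 2 * a by rewrite sqr_sqrtr//; lra.
  have : (1 + a * E) * q <= 1 by rewrite -ler_pdivlMr// div1r.
  rewrite -exprMn => hle; rewrite exprn_ile1// mulr_ge0// ltW//.
(* [key] compares [1 + a t^2] with [exp (a t^2)]; either strict inequality
   between [E] and [1] contradicts it for a small [a]. *)
apply/eqP; rewrite eq_le; apply/andP; split; rewrite leNgt; apply/negP => hE.
(* [D] makes the first-order gain 2 a (E - 1) equal to 2 a^2 D, which exceeds the terms of higher
   order. *)
- pose D := 4 * E + E ^+ 2.
  have D0 : 0 < D by rewrite /D; nra.
  pose a := (E - 1) / D.
  have aD : a * D = E - 1 by rewrite /a divfK// gt_eqF.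
  have a0 : 0 < a by rewrite divr_gt0// subr_gt0.
  have a4 : 4 * a <= 1.
    by rewrite -(ler_pM2r D0) mul1r -mulrA aD /D; nra.
  have aE0 : 0 <= 1 + a * E by rewrite addr_ge0// mulr_ge0// ltW.
  have := key a a4 aE0.
  have -> : (1 + a * E) ^+ 2 * (1 - 2 * a) =
    1 + 2 * a * (E - 1) - a ^+ 2 * (4 * E - E ^+ 2 + 2 * a * E ^+ 2) by ring.
  rewrite -aD.
  have : 0 < a ^+ 2 by rewrite exprn_gt0.
  rewrite /D; set a2 := a ^+ 2 => a20.
  have -> : 2 * a * (a * (4 * E + E ^+ 2)) = a2 * (8 * E + 2 * E ^+ 2) by rewrite /a2; ring.
  have E2 : 0 < E ^+ 2 by rewrite exprn_gt0// (lt_trans _ hE).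
  have : a * E ^+ 2 <= E ^+ 2 by apply: ler_piMl; [exact: ltW|lra].
  have : 0 < 4 * E + E ^+ 2 by [].
  nra.
- pose a := (1 - E) / 4.
  have a0 : 0 < a by rewrite /a; lra.
  have := key (- a); have -> : 4 * - a <= 1 by lra.
  have -> : 0 <= 1 + - a * E by rewrite /a; nra.
  move=> /(_ isT isT); have -> : E = 1 - 4 * a by rewrite /a; lra.
  move=> hh.
  have {}hh : (1 - a * (1 - 4 * a)) ^+ 2 * (1 + 2 * a) - 1 <= 0 by lra.
  have a4 : a <= 4^-1 by rewrite /a; lra.
  move: hh.
  have -> : (1 - a * (1 - 4 * a)) ^+ 2 * (1 + 2 * a) - 1 = a ^+ 2 * (5 + 10 * a + 32 * a ^+ 3) by ring.
  rewrite leNgt mulr_gt0// ?exprn_gt0//.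
  have : 0 < a ^+ 3 by rewrite exprn_gt0.
  lra.
Qed.

(** The polynomials t^2 - 1, t and 1 are orthogonal under N(0, 1), so no cross terms survive; this
    lets quadratic forms be treated one coordinate at a time. Adding the integrand at -t removes the
    odd powers, and 600 is a generous bound for the mean of (t^2 - 1)^2. *)
Lemma normal_quadratic (a b c : R) :
  (\int[N]_t ((a * (t ^+ 2 - 1) + b * t + c) ^+ 2)%:E
   <= (600 * a ^+ 2 + b ^+ 2 + c ^+ 2)%:E)%E.
Proof.
pose f b t : \bar R := ((a * (t ^+ 2 - 1) + b * t + c) ^+ 2)%:E.
have mquad (b' : R) : measurable_fun setT (f b').
  apply/measurable_EFinP/measurable_funX.
  apply: measurable_funD => //; apply: measurable_funD; apply: measurable_funM => //.
  by apply: measurable_funB => //; exact: measurable_funX.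
have f0 b' t : (0 <= f b' t)%E by rewrite lee_fin sqr_ge0.
rewrite -/(f b).
have i2 := integrable_normalX2.
have m4 : measurable_fun setT (fun t : R => (t ^+ 4)%:E).
  by apply/measurable_EFinP; exact: measurable_funX.
have i4 : N.-integrable setT (fun t => (t ^+ 4)%:E).
  apply/integrableP; split=> //.
  under eq_integral do rewrite gee0_abs ?lee_fin ?exprn_even_ge0//.
  by rewrite (le_lt_trans normal_moment4)// ltry.
have fi4 := integrable_fin_num measurableT i4.
set E4 := fine (\int[N]_t (t ^+ 4)%:E)%E.
have E4le : E4 <= 256 by rewrite -lee_fin fineK//; exact: normal_moment4.
have : (2%:E * \int[N]_t f b t =
  \int[N]_t (((2 * a ^+ 2)%:E * (t ^+ 4)%:E + ((4 * a * (c - a) + 2 * b ^+ 2)%:E * (t ^+ 2)%:E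
   + (2 * (c - a) ^+ 2)%:E))))%E.
  have -> : (2%:E * \int[N]_t f b t = \int[N]_t f b t + \int[N]_t f b (- t)%R)%E.
    by rewrite normal_prob_sym// mule_natl.
  rewrite -ge0_integralD//; [|exact: mquad|exact: measurableT_comp (mquad b) _].
  by apply: eq_integral => t _; rewrite /f -!EFinM -!EFinD; congr EFin; ring.
rewrite integralD//; last 2 first.
  by apply: integrableZl.
  by apply: integrableD => //; [exact: integrableZl|exact: finite_measure_integrable_cst].
rewrite integralD//; last 2 first.
  by apply: integrableZl.
  exact: finite_measure_integrable_cst.
rewrite !integralZl// integral_cst//= probability_setT mule1 normal_moment2 mule1.
rewrite -(fineK fi4) -/E4 -!EFinM -!EFinD => h.
rewrite -(@lee_pmul2l _ 2%:E)// h -EFinM lee_fin.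
have := sqr_ge0 a; nra.
Qed.

End gaussian_moments.

(** * Integrability of an inverse square root under the Gaussian law *)

Section singular.
Context {R : realType}.
Local Notation mu := (@lebesgue_measure R).
Local Notation N := (@normal_prob R 0 1).

Definition dyadic_term (k : nat) (t : R) : \bar R :=
  (2 ^+ k * \1_`[- 4 ^- k, 4 ^- k] t)%:E.

(* A measurable majorant of [|t|^(-1/2)]: the sum of the [2^k] over the [k]
   with [|t| <= 4^-k] is geometric, and finite unless [t = 0]. *)
Definition sqrt_sing (t : R) : \bar R := (1 + 2%:E * \sum_(k <oo) dyadic_term k t)%E.

Lemma dyadic_term_ge0 k t : (0 <= dyadic_term k t)%E.
Proof. by rewrite lee_fin mulr_ge0// exprn_ge0. Qed.

Lemma measurable_dyadic_term k : measurable_fun setT (dyadic_term k).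
Proof. by apply/measurable_EFinP; apply: measurable_funM. Qed.

Lemma dyadic_sum_ge0 t : (0 <= \sum_(k <oo) dyadic_term k t)%E.
Proof. by apply: nneseries_ge0 => k _ _; exact: dyadic_term_ge0. Qed.

Lemma sqrt_sing_ge1 t : (1 <= sqrt_sing t)%E.
Proof. by rewrite /sqrt_sing leeDl// mule_ge0// dyadic_sum_ge0. Qed.

Lemma measurable_sqrt_sing : measurable_fun setT sqrt_sing.
Proof.
apply: emeasurable_funD => //; apply: emeasurable_funM => //.
apply: ge0_emeasurable_sum => //.
- by move=> k t _ _; exact: dyadic_term_ge0.
- by move=> k _; exact: measurable_dyadic_term.
Qed.

(** If 4^-(k+1) < |t| <= 4^-k, the term k gives w >= 2^(k+1), so w^4 t^2 >= 16^(k+1) 16^-(k+1). The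
    factor 2 in [sqrt_sing] pays for this rounding, and its summand 1 covers |t| > 1. *)
Lemma sqrt_sing_key t w : sqrt_sing t = w%:E -> 1 <= w ^+ 4 * t ^+ 2.
Proof.
move=> tw.
have w1 : 1 <= w by rewrite -lee_fin -tw sqrt_sing_ge1.
have step k : `|t| <= 4 ^- k -> 2 ^+ k.+1 <= w.
  move=> tk; rewrite -lee_fin -tw /sqrt_sing.
  have h : (dyadic_term k t <= \sum_(k <oo) dyadic_term k t)%E.
    rewrite (@nneseriesD1 _ _ k)//; last by move=> i _; exact: dyadic_term_ge0.
    by rewrite leeDl// nneseries_ge0// => i _ _; exact: dyadic_term_ge0.
  apply: (@le_trans _ _ (2%:E * dyadic_term k t)%E).
    rewrite /dyadic_term indicE mem_set ?mulr1 -?EFinM ?exprS//=.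
    by rewrite in_itv/= -ler_norml.
  by apply: (@le_trans _ _ (2%:E * \sum_(k <oo) dyadic_term k t)%E); [exact: lee_wpmul2l|exact: leeDr].
(* Otherwise every 2^(k+1) would be at most the finite number [w]. *)
have ex : exists k, 4 ^- k < `|t|.
  apply: contrapT => /forallNP h.
  pose k := Num.bound w.
  have := step k; have /negP := h k; rewrite -leNgt => -> /(_ isT) hw.
  have : k%:R < 2 ^+ k.+1 :> R.
    by rewrite -natrX ltr_nat (leq_trans (ltn_expl k (isT : (1 < 2)%N)))// leq_exp2l.
  have := archi_boundP (le_trans ler01 w1); rewrite -/k; lra.
have [k hk hmin] := ex_minnP ex.
case: k hk hmin => [|k] hk hmin.
  rewrite expr0 invr1 in hk.
  have t2 : 1 <= t ^+ 2 by rewrite -(real_normK (num_real t)) exprn_ege1// ltW.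
  have w4 : 1 <= w ^+ 4 by rewrite exprn_ege1.
  nra.
have tk : `|t| <= 4 ^- k by rewrite leNgt; apply/negP => /hmin; rewrite ltnn.
have wk := step k tk.
have w4 : (2 ^+ k.+1) ^+ 4 <= w ^+ 4 by rewrite lerXn2r// ?nnegrE ?exprn_ge0// (le_trans ler01).
have t2 : (4 ^- k.+1) ^+ 2 <= t ^+ 2.
  by rewrite -(real_normK (num_real t)) lerXn2r// ?nnegrE ?invr_ge0 ?exprn_ge0// ltW.
apply: le_trans (ler_pM _ _ w4 t2); rewrite ?exprn_ge0 ?invr_ge0 ?exprn_ge0//.
rewrite -exprM mulnC exprM (_ : 2 ^+ 4 = 4 ^+ 2); last by ring.
by rewrite -exprM mulnC exprM exprVn divff// !expf_neq0.
Qed.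

Lemma normal_prob_le_lebesgue (A : set R) : measurable A -> (N A <= mu A)%E.
Proof.
move=> mA; rewrite /normal_prob -[leRHS]mul1e -(integral_cst mu mA).
apply: ge0_le_integral => //.
- by move=> x _; rewrite lee_fin normal_pdf_ge0.
- by apply/measurable_EFinP/measurable_funTS; exact: measurable_normal_pdf.
- move=> x _; rewrite lee_fin; apply: le_trans (normal_pdf_ub _ _ (oner_neq0 _)) _.
  rewrite /normal_peak expr1n mul1r invf_le1; last first.
    by rewrite sqrtr_gt0 mulrn_wgt0// pi_gt0.
  rewrite -[leLHS]sqrtr1 ler_wsqrtr// -mulr_natr.
  have := @pi_ge2 R; lra.
Qed.

(** An interval of half-length 4^-k has Gaussian mass at most twice 4^-k, so the terms decay like
    2^-k and sum to at most 4; then 9 = 1 + 2 * 4. *)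
Lemma integral_sqrt_sing : (\int[N]_t sqrt_sing t <= 9%:E)%E.
Proof.
have ms : measurable_fun setT (fun t : R => \sum_(k <oo) dyadic_term k t)%E.
  apply: ge0_emeasurable_sum => //.
  - by move=> k t _ _; exact: dyadic_term_ge0.
  - by move=> k _; exact: measurable_dyadic_term.
rewrite ge0_integralD//; last 2 first.
  by move=> t _; rewrite mule_ge0// dyadic_sum_ge0.
  by apply: emeasurable_funM.
rewrite integral_cst//= probability_setT mule1.
rewrite ge0_integralZl_EFin//; last by move=> t _; exact: dyadic_sum_ge0.
rewrite integral_nneseries//; last 2 first.
  by move=> k; exact: measurable_dyadic_term.
  by move=> k t _; exact: dyadic_term_ge0.
suff : (\sum_(k <oo) \int[N]_t dyadic_term k t <= 4%:E)%E.
  have h2 : (0 <= 2%:E :> \bar R)%E by [].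
  move=> /(lee_wpmul2l h2); rewrite -EFinM => h.
  by apply: (le_trans (leeD2l _ h)); rewrite -EFinD lee_fin; lra.
have term k : (\int[N]_t dyadic_term k t <= (2 * 2 ^- k)%:E)%E.
  under eq_integral do rewrite /dyadic_term EFinM.
  rewrite ge0_integralZl_EFin//; last exact/measurable_EFinP.
  rewrite integral_indic// setIT.
  apply: (@le_trans _ _ ((2 ^+ k)%:E * mu `[(- 4 ^- k)%R, (4 ^- k)%R]%classic)%E).
    by rewrite lee_pmul2l// ?lte_fin ?exprn_gt0// normal_prob_le_lebesgue.
  rewrite lebesgue_measure_itv/= lte_fin gtrN ?invr_gt0 ?exprn_gt0//.
  rewrite -EFinB -EFinM lee_fin opprK.
  have -> : 4 ^- k = 2 ^- k * 2 ^- k :> R.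
    by rewrite -invfM -exprMn; congr (_ ^- _); ring.
  by rewrite -mulrDl mulrA mulrDr divff ?expf_neq0.
apply: lime_le.
  by apply: is_cvg_nneseries => k _ _; apply: integral_ge0 => t _; exact: dyadic_term_ge0.
near=> n.
apply: (@le_trans _ _ (\sum_(0 <= k < n) (2 * 2 ^- k)%:E)%E); first exact: lee_sum.
rewrite sumEFin lee_fin.
have -> : \sum_(0 <= k < n) (2 * 2 ^- k) = 4 - 4 * 2 ^- n :> R.
  elim: {+}n => [|m IH]; first by rewrite big_geq// expr0 invr1; lra.
  by rewrite big_nat_recr//= IH exprS invfM; field; rewrite expf_neq0.
by rewrite lerBlDr lerDl mulr_ge0// invr_ge0 exprn_ge0.
Unshelve. all: end_near. Qed.

End singular.

(** * Powers of a probability measure *)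

Section product_power.
Context d (T : measurableType d) {R : realType} (N : probability T R).

Definition cons_pair (n : nat) (x : T * n.-tuple T) : n.+1.-tuple T :=
  [tuple of x.1 :: x.2].

Lemma measurable_cons_pair n : measurable_fun setT (@cons_pair n).
Proof. by apply: measurable_cons. Qed.

HB.instance Definition _ n :=
  isMeasurableFun.Build _ _ _ _ (@cons_pair n) (@measurable_cons_pair n).

(** Coordinates are adjoined one at a time, so that Fubini turns statements about n coordinates into
    inductions on the head. *)
Fixpoint prob_power (n : nat) : probability (n.-tuple T) R :=
  match n with
  | 0 => dirac ([tuple] : 0.-tuple T)
  | m.+1 => distribution (N \x prob_power m)%E (@cons_pair m)
  end.

Lemma integral_prob_power0 (F : 0.-tuple T -> \bar R) :
  measurable_fun setT F -> (forall x, 0 <= F x)%E ->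
  (\int[prob_power 0]_x F x = F [tuple])%E.
Proof. by move=> mF F0; rewrite integral_dirac// diracT mul1e. Qed.

Lemma integral_prob_powerS n (F : n.+1.-tuple T -> \bar R) :
  measurable_fun setT F -> (forall x, 0 <= F x)%E ->
  (\int[prob_power n.+1]_x F x =
   \int[N]_t \int[prob_power n]_x F [tuple of t :: x])%E.
Proof.
move=> mF F0.
rewrite ge0_integral_distribution//.
rewrite fubini_tonelli1//; last by move=> x; exact: F0.
by apply: measurableT_comp => //; exact: measurable_cons_pair.
Qed.

Lemma integral_prob_powerS_swap n (F : n.+1.-tuple T -> \bar R) :
  measurable_fun setT F -> (forall x, 0 <= F x)%E ->
  (\int[prob_power n.+1]_x F x =
   \int[prob_power n]_x \int[N]_t F [tuple of t :: x])%E.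
Proof.
move=> mF F0; rewrite integral_prob_powerS//.
rewrite (fubini_tonelli (fun z : T * n.-tuple T => F (cons_pair z)))//.
by apply: measurableT_comp => //; exact: measurable_cons_pair.
Qed.

Lemma prob_power_box n (B : 'I_n -> set T) : (forall i, measurable (B i)) ->
  prob_power n [set x | forall i, B i (tnth x i)] = (\prod_(i < n) N (B i))%E.
Proof.
elim: n B => [|n IH] B mB.
  rewrite big_ord0 /= diracE mem_set// => -[]//.
rewrite big_ord_recl -IH//.
rewrite /= /distribution /pushforward /=.
set A := (X in (N \x _)%E X).
have -> : A = B ord0 `*` [set x | forall i, B (lift ord0 i) (tnth x i)].
  apply/seteqP; split=> -[t x] /=.
    move=> h; split=> [|i].
      by have := h ord0; rewrite tnth0.
    by have := h (lift ord0 i); rewrite tnthS.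
  move=> [h0 h] i; case: (unliftP ord0 i) => [j ->|->].
    by rewrite tnthS.
  by rewrite tnth0.
rewrite product_measure1E//.
have -> : [set x : n.-tuple T| forall i : 'I_n, B (lift ord0 i) (tnth x i)] =
   \bigcap_(i in setT) ((fun x => tnth x i) @^-1` (B (lift ord0 i))).
  by apply/seteqP; split => x /= h i; [move=> _|]; exact: h.
apply: fin_bigcap_measurable => // i _.
rewrite -[X in measurable X]setTI.
exact: measurable_tnth.
Qed.

Lemma measurable_box n (B : 'I_n -> set T) : (forall i, measurable (B i)) ->
  measurable [set x : n.-tuple T | forall i, B i (tnth x i)].
Proof.
move=> mB.
have -> : [set x : n.-tuple T| forall i : 'I_n, B i (tnth x i)] =
   \bigcap_(i in setT) ((fun x => tnth x i) @^-1` (B i)).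
  by apply/seteqP; split => x /= h i; [move=> _|]; exact: h.
apply: fin_bigcap_measurable => // i _.
rewrite -[X in measurable X]setTI.
exact: measurable_tnth.
Qed.

(** Boxes are stable under intersection and generate the product sigma-algebra: a cylinder over one
    coordinate is a box with full sides elsewhere. *)
Lemma prob_power_unique n (m : probability (n.-tuple T) R) :
  (forall B : 'I_n -> set T, (forall i, measurable (B i)) ->
    m [set x | forall i, B i (tnth x i)] = (\prod_(i < n) N (B i))%E) ->
  forall A, measurable A -> m A = prob_power n A.
Proof.
move=> mbox A mA.
pose G : set (set (n.-tuple T)) :=
  [set [set x | forall i, B i (tnth x i)] | B in [set B : 'I_n -> set T | forall i, measurable (B i)]].
apply: (measure_unique G (fun=> setT)) => //.
- rewrite {1}/measurable/= /g_sigma_preimage; apply/seteqP; split.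
  + apply: smallest_sub; first exact: smallest_sigma_algebra.
    rewrite -bigcup_seq => X [i _ [B mB <-]]; apply: sub_sigma_algebra.
    exists (fun j => if j == i then B else setT).
      by move=> j /=; case: ifP.
    apply/seteqP; split=> x /=.
      by move=> /(_ i); rewrite eqxx.
    by move=> [_ h] j; case: ifP => // /eqP ->.
  + apply: smallest_sub; first exact: smallest_sigma_algebra.
    move=> _ [B mB <-]; exact: measurable_box.
- move=> _ _ [B mB <-] [B' mB' <-]; exists (fun i => B i `&` B' i).
    by move=> i; exact: measurableI.
  apply/seteqP; split=> x /=; first by move=> h; split=> i; case: (h i).
  by move=> [h h'] i; split.
- move=> _; exists (fun=> setT) => //.
  by apply/seteqP; split.
- by rewrite bigcup_const.
- by move=> _ [B mB <-]; exact: etrans (mbox B mB) (esym (prob_power_box mB)).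
- by move=> _; apply: le_lt_trans (probability_le1 m measurableT) (ltry _).
Qed.

Lemma measurable_prod_tnth m (h : 'I_m -> T -> \bar R) : (forall i, measurable_fun setT (h i)) ->
  measurable_fun setT (fun x : m.-tuple T => \prod_(i < m) h i (tnth x i))%E.
Proof.
move=> mh; elim: (index_enum _) => [|i s IHs].
  rewrite (_ : (fun _ => _) = cst 1%E); first exact: measurable_cst.
  by apply/funext => x; rewrite big_nil.
rewrite (_ : (fun _ => _) = (fun x => h i (tnth x i) * \prod_(j <- s) h j (tnth x j))%E).
  2: by apply/funext => x; rewrite big_cons.
by apply: emeasurable_funM => //; apply: measurableT_comp => //; exact: measurable_tnth.
Qed.

Lemma prob_power_prod n (g : 'I_n -> T -> \bar R) :
  (forall i, measurable_fun setT (g i)) -> (forall i t, 0 <= g i t)%E ->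
  (\int[prob_power n]_x \prod_(i < n) g i (tnth x i) =
   \prod_(i < n) \int[N]_t g i t)%E.
Proof.
elim: n g => [|n IH] g mg g0.
  rewrite big_ord0; under eq_integral do rewrite big_ord0.
  by rewrite integral_prob_power0.
have p0 m (h : 'I_m -> T -> \bar R) (x : m.-tuple T) : (forall i t, 0 <= h i t)%E ->
    (0 <= \prod_(i < m) h i (tnth x i))%E.
  by move=> h0; apply: prode_ge0.
rewrite integral_prob_powerS; last 2 first.
- exact: measurable_prod_tnth.
- by move=> x; exact: p0.
rewrite big_ord_recl.
have P0 : (0 <= \prod_(i < n) \int[N]_t g (lift ord0 i) t)%E.
  by apply: prode_ge0 => i *; apply: integral_ge0 => t _; exact: g0.
transitivity (\int[N]_t (g ord0 t * \prod_(i < n) \int[N]_t g (lift ord0 i) t))%E.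
  apply: eq_integral => t _.
  rewrite -IH//.
  rewrite -ge0_integralZl//; last 2 first.
  - exact: (@measurable_prod_tnth _ (fun i => g (lift ord0 i))).
  - by move=> x _; exact: (p0 _ (fun i => g (lift ord0 i))).
  apply: eq_integral => x _; rewrite big_ord_recl; congr (_ * _)%E.
  by apply: eq_bigr => i _; rewrite tnthS.
by rewrite ge0_integralZr.
Qed.

End product_power.

Lemma ge0_measurable_fun_integral d1 d2 (T1 : measurableType d1) (T2 : measurableType d2)
  (R : realType) (m : probability T2 R) (F : T1 * T2 -> \bar R) :
  measurable_fun setT F -> (forall z, 0 <= F z)%E ->
  measurable_fun setT (fun x => \int[m]_y F (x, y))%E.
Proof. by move=> mF F0; exact: (measurable_fun_fubini_tonelli_F F). Qed.

Lemma measurable_fst_comp d d1 d2 (T : measurableType d) (T1 : measurableType d1)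
  (T2 : measurableType d2) (g : T -> T1 * T2) :
  measurable_fun setT g -> measurable_fun setT (fun z => (g z).1).
Proof. by move=> mg; apply: (measurableT_comp measurable_fst mg). Qed.

Lemma measurable_snd_comp d d1 d2 (T : measurableType d) (T1 : measurableType d1)
  (T2 : measurableType d2) (g : T -> T1 * T2) :
  measurable_fun setT g -> measurable_fun setT (fun z => (g z).2).
Proof. by move=> mg; apply: (measurableT_comp measurable_snd mg). Qed.

Ltac measurable_projection :=
  repeat first [exact: measurable_id | exact: measurable_cst
    | apply: measurable_fst_comp | apply: measurable_snd_comp].

(** * Concentration of coordinatewise Lipschitz functions *)

Section symmetrized_mgf.
Context {R : realType}.
Local Notation N := (@normal_prob R 0 1).
Local Notation T := (measurableTypeR R).
Local Notation P := (prob_power N).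

Lemma cosh_le (z w : R) : `|z| <= `|w| -> expR z + expR (- z) <= expR w + expR (- w).
Proof.
have abs (a : R) : expR a + expR (- a) = expR `|a| + expR (- `|a|).
  by have [a0|a0] := leP 0 a; [rewrite ger0_norm|rewrite ltr0_norm// opprK addrC].
rewrite (abs z) (abs w) => zw; move: (normr_ge0 z) zw.
move: `|z| `|w| => a b a0 ab.
rewrite -subr_ge0 !expRN.
have ea := expR_gt0 a; have eb := expR_gt0 b.
have eab : expR a <= expR b by rewrite ler_expR.
have ea1 : 1 <= expR a by rewrite -expR0 ler_expR.
have -> : expR b + (expR b)^-1 - (expR a + (expR a)^-1) =
  (expR b - expR a) * (1 - (expR a * expR b)^-1).
  by field; rewrite !gt_eqF.
rewrite mulr_ge0 ?subr_ge0// invf_le1 ?mulr_gt0//.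
by nra.
Qed.

(** Exchanging the variables shows that twice the double integral of [K] is that of K t s + K s t;
    only this symmetric sum, where the first-order terms cancel, has a good bound. *)
Lemma exchangeable_pair_bound (e c : R) (K : T -> T -> \bar R) : 0 <= e ->
  (forall t s, 0 <= K t s)%E -> measurable_fun setT (fun z : T * T => K z.1 z.2) ->
  (forall t s : T, K t s + K s t <= e%:E *
    (expR (c * t) * expR (- c * s) + expR (- c * t) * expR (c * s))%:E)%E ->
  (\int[N]_t \int[N]_s K t s <= (e * expR (c ^+ 2))%:E)%E.
Proof.
move=> e_ge0 K0 mK Kb.
have mE (a b : R) : measurable_fun setT (fun z : T * T => (expR (a * z.1) * expR (b * z.2))%:E).
  apply/measurable_EFinP/measurable_funM; apply: measurableT_comp => //;
    by apply: measurable_funM => //.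
have eprod (a b : R) : (\int[N]_t \int[N]_s (expR (a * t) * expR (b * s))%:E =
    (expR ((a ^+ 2 + b ^+ 2) / 2))%:E)%E.
  have m1 (q : R) : measurable_fun setT (fun s : R => (expR (q * s))%:E).
    by apply/measurable_EFinP/measurableT_comp => //; exact: measurable_funM.
  transitivity (\int[N]_t ((expR (a * t))%:E * (expR (b ^+ 2 / 2))%:E))%E.
    apply: eq_integral => t _; under eq_integral do rewrite EFinM.
    by rewrite ge0_integralZl ?normal_mgf//; exact: m1.
  rewrite ge0_integralZr ?normal_mgf//; last exact: m1.
  by rewrite -EFinM -expRD mulrDl.
have mKswap : measurable_fun setT (fun z : T * T => K z.2 z.1).
  have ms : measurable_fun setT (fun z : T * T => (z.2, z.1)) by exact: measurable_fun_pair.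
  exact: (measurableT_comp mK ms).
have swapK : (\int[N]_t \int[N]_s K t s = \int[N]_t \int[N]_s K s t)%E.
  by apply: (fubini_tonelli (fun z : T * T => K z.1 z.2)) => // z; exact: K0.
rewrite -(@lee_pmul2l _ 2%:E)//.
have -> : (2%:E * \int[N]_t \int[N]_s K t s =
    \int[N]_t \int[N]_s K t s + \int[N]_t \int[N]_s K s t)%E.
  by rewrite -swapK mule_natl mule2n.
rewrite -ge0_integralD//; last 4 first.
- by move=> t _; exact: integral_ge0.
- by apply: (@ge0_measurable_fun_integral _ _ T T _ _ (fun z => K z.1 z.2)) => // z; exact: K0.
- by move=> t _; exact: integral_ge0.
- by apply: (@ge0_measurable_fun_integral _ _ T T _ _ (fun z => K z.2 z.1)) => // z; exact: K0.
pose g (a b : R) (t s : T) := (expR (a * t) * expR (b * s))%:E.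
have g0 a b t s : (0 <= g a b t s)%E by rewrite lee_fin mulr_ge0 ?expR_ge0.
have mg2 a b t : measurable_fun setT (g a b t).
  by apply: (measurable_fun_pair2 (f := fun z : T * T => g a b z.1 z.2)); exact: mE.
have mg1 a b : measurable_fun setT (fun t => \int[N]_s g a b t s)%E.
  by apply: (@ge0_measurable_fun_integral _ _ T T _ _ (fun z => g a b z.1 z.2)) => [|z]; [exact: mE|exact: g0].
apply: (@le_trans _ _ (\int[N]_t (e%:E * ((\int[N]_s g c (- c)%R t s) + (\int[N]_s g (- c)%R c t s))))%E).
  apply: ge0_le_integral => //.
  - by move=> t _; rewrite adde_ge0//; exact: integral_ge0.
  - apply: emeasurable_funD.
      by apply: (@ge0_measurable_fun_integral _ _ T T _ _ (fun z => K z.1 z.2)) => // z; exact: K0.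
    by apply: (@ge0_measurable_fun_integral _ _ T T _ _ (fun z => K z.2 z.1)) => // z; exact: K0.
  - by apply: emeasurable_funM => //; apply: emeasurable_funD.
  - move=> t _.
    rewrite -ge0_integralD//; last 2 first.
    + exact: (measurable_fun_pair2 (f := fun z : T * T => K z.1 z.2)).
    + exact: (measurable_fun_pair2 (f := fun z : T * T => K z.2 z.1)).
    rewrite -ge0_integralD//.
    rewrite -ge0_integralZl//; last 2 first.
    + exact: emeasurable_funD.
    + by move=> s _; rewrite adde_ge0.
    apply: ge0_le_integral => //.
    + by move=> s _; rewrite adde_ge0.
    + apply: emeasurable_funD.
        exact: (measurable_fun_pair2 (f := fun z : T * T => K z.1 z.2)).
      exact: (measurable_fun_pair2 (f := fun z : T * T => K z.2 z.1)).
    + by apply: emeasurable_funM => //; apply: emeasurable_funD.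
have ge0S t : (0 <= (\int[N]_s g c (- c)%R t s) + (\int[N]_s g (- c)%R c t s))%E.
  by rewrite adde_ge0//; exact: integral_ge0.
have mS : measurable_fun setT (fun t => (\int[N]_s g c (- c)%R t s) + (\int[N]_s g (- c)%R c t s))%E.
  exact: emeasurable_funD.
have e0E : (0 <= e%:E)%E by rewrite lee_fin.
rewrite (ge0_integralZl N measurableT mS (fun t _ => ge0S t) e0E).
rewrite ge0_integralD//; [|by move=> t _; exact: integral_ge0..].
rewrite !eprod -EFinD -!EFinM lee_fin sqrrN.
have -> : (c ^+ 2 + c ^+ 2) / 2 = c ^+ 2 by field.
by rewrite -mulr2n -[expR _ *+ 2]mulr_natl mulrCA.
Qed.

(** Induction on the number of coordinates, splitting off the pair of heads. Comparing two copies
    makes the estimate invariant under adding a constant to [f]. *)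
Lemma symmetrized_mgf_coord_lipschitz (n : nat) (c : R) (f : n.-tuple T -> R) :
  0 <= c -> measurable_fun setT f ->
  (forall x y, `|f x - f y| <= c * \sum_(i < n) `|tnth x i - tnth y i|) ->
  (\int[P n]_x \int[P n]_y (expR (f x - f y))%:E <= (expR (n%:R * c ^+ 2))%:E)%E.
Proof.
move=> c0; elim: n f => [|n IH] f mf lipf.
  rewrite integral_prob_power0//; last 2 first.
  - apply: (@ge0_measurable_fun_integral _ _ _ _ _ _ (fun z => (expR (f z.1 - f z.2))%:E)) => //.
    apply/measurable_EFinP/measurableT_comp => //.
    by apply: measurable_funB; apply: measurableT_comp.
  - by move=> x; apply: integral_ge0 => y _; rewrite lee_fin expR_ge0.
  rewrite integral_prob_power0//.
    by rewrite subrr mul0r.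
  by apply/measurable_EFinP/measurableT_comp => //; exact: measurable_funB.
have mcons d (T0 : measurableType d) (a : T0 -> T) (b : T0 -> n.-tuple T) :
    measurable_fun setT a -> measurable_fun setT b ->
    measurable_fun setT (fun z => f [tuple of a z :: b z]).
  by move=> ma mb; apply: measurableT_comp => //; exact: measurable_cons.
have mphi d (T0 : measurableType d) (a a' : T0 -> T) (b b' : T0 -> n.-tuple T) :
    measurable_fun setT a -> measurable_fun setT b ->
    measurable_fun setT a' -> measurable_fun setT b' ->
    measurable_fun setT (fun z => (expR (f [tuple of a z :: b z] - f [tuple of a' z :: b' z]))%:E).
  move=> *; apply/measurable_EFinP/measurableT_comp => //.
  by apply: measurable_funB; exact: mcons.
have e0 z : (0 <= (expR z)%:E :> \bar R)%E by rewrite lee_fin expR_ge0.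
pose K (t s : R) : \bar R :=
  (\int[P n]_x \int[P n]_y (expR (f [tuple of t :: x] - f [tuple of s :: y]))%:E)%E.
have K0 t s : (0 <= K t s)%E by apply: integral_ge0 => x _; exact: integral_ge0.
have mK : measurable_fun setT (fun z : T * T => K z.1 z.2).
  apply: (@ge0_measurable_fun_integral _ _ _ _ _ _ (fun z : (T * T) * n.-tuple T =>
     \int[P n]_y (expR (f [tuple of z.1.1 :: z.2] - f [tuple of z.1.2 :: y]))%:E))%E.
    apply: (@ge0_measurable_fun_integral _ _ _ _ _ _ (fun z : ((T * T) * n.-tuple T) * n.-tuple T =>
     (expR (f [tuple of z.1.1.1 :: z.1.2] - f [tuple of z.1.1.2 :: z.2]))%:E))%E => //.
    by apply: mphi; measurable_projection.
  by move=> z; exact: integral_ge0.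
have JE : (\int[P n.+1]_x \int[P n.+1]_y (expR (f x - f y))%:E = \int[N]_t \int[N]_s K t s)%E.
  rewrite integral_prob_powerS; last 2 first.
  - apply: (@ge0_measurable_fun_integral _ _ _ _ _ _ (fun z => (expR (f z.1 - f z.2))%:E)) => //.
    apply/measurable_EFinP/measurableT_comp => //.
    by apply: measurable_funB; apply: measurableT_comp.
  - by move=> x; exact: integral_ge0.
  apply: eq_integral => t _.
  transitivity (\int[P n]_x \int[N]_s \int[P n]_y
      (expR (f [tuple of t :: x] - f [tuple of s :: y]))%:E)%E.
    apply: eq_integral => x _; rewrite integral_prob_powerS//.
    by apply/measurable_EFinP/measurableT_comp => //; exact: measurable_funB.
  rewrite (fubini_tonelli (fun z : n.-tuple T * T => \int[P n]_y
      (expR (f [tuple of t :: z.1] - f [tuple of z.2 :: y]))%:E))%E//.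
  - apply: (@ge0_measurable_fun_integral _ _ _ _ _ _ (fun z : (n.-tuple T * T) * n.-tuple T =>
     (expR (f [tuple of t :: z.1.1] - f [tuple of z.1.2 :: z.2]))%:E))%E => //.
    by apply: mphi; measurable_projection.
  - by move=> z; exact: integral_ge0.
rewrite JE.
(* Exchanging [t] and [s] turns the increment of [f] in the first coordinate
   into its opposite, so the sum of both terms is a cosh of that increment. *)
have Kb (t s : T) : (K t s + K s t <= (expR (n%:R * c ^+ 2))%:E * (expR (c * t) * expR (- c * s) + expR (- c * t) * expR (c * s))%:E)%E.
  (* Averaging over the two heads keeps the Lipschitz constant, so the induction hypothesis applies
     to [h]; what remains is [u] + [v] below, of size at most c |t - s|. *)
  pose h (x : n.-tuple T) := (f [tuple of t :: x] + f [tuple of s :: x]) / 2.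
  have mh : measurable_fun setT h.
    by apply: measurable_funM => //; apply: measurable_funD; exact: mcons.
  have lips (a : T) (x y : n.-tuple T) : `|f [tuple of a :: x] - f [tuple of a :: y]| <= c * \sum_(i < n) `|tnth x i - tnth y i|.
    apply: le_trans (lipf _ _) _; rewrite big_ord_recl.
    rewrite subrr normr0 add0r ler_wpM2l// ler_sum// => i _.
    by rewrite !tnthS.
  have liph (x y : n.-tuple T) : `|h x - h y| <= c * \sum_(i < n) `|tnth x i - tnth y i|.
    have := lips t x y; have := lips s x y.
    rewrite /h; set S := c * _ => h1 h2.
    have -> : (f [tuple of t :: x] + f [tuple of s :: x]) / 2 - (f [tuple of t :: y] + f [tuple of s :: y]) / 2
       = ((f [tuple of t :: x] - f [tuple of t :: y]) + (f [tuple of s :: x] - f [tuple of s :: y])) / 2.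
      by field.
    rewrite normrM (ger0_norm (_ : 0 <= 2^-1))// ler_pdivrMr//.
    by apply: le_trans (ler_normD _ _) _; lra.
  have hd (x : n.-tuple T) : `|f [tuple of t :: x] - f [tuple of s :: x]| <= c * `|t - s|.
    apply: le_trans (lipf _ _) _; rewrite big_ord_recl [X in _ + X]big1 ?addr0//.
    by move=> i _; rewrite !tnthS subrr normr0.
  have mexph : measurable_fun setT (fun z : n.-tuple T * n.-tuple T => (expR (h z.1 - h z.2))%:E).
    apply/measurable_EFinP/measurableT_comp => //.
    by apply: measurable_funB; apply: measurableT_comp.
  rewrite /K -ge0_integralD//; last 4 first.
  - by move=> x _; exact: integral_ge0.
  - apply: (@ge0_measurable_fun_integral _ _ _ _ _ _ (fun z : n.-tuple T * n.-tuple T =>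
     (expR (f [tuple of t :: z.1] - f [tuple of s :: z.2]))%:E))%E => //.
    by apply: mphi; measurable_projection.
  - by move=> x _; exact: integral_ge0.
  - apply: (@ge0_measurable_fun_integral _ _ _ _ _ _ (fun z : n.-tuple T * n.-tuple T =>
     (expR (f [tuple of s :: z.1] - f [tuple of t :: z.2]))%:E))%E => //.
    by apply: mphi; measurable_projection.
  set E := (expR (c * t) * expR (- c * s) + expR (- c * t) * expR (c * s)).
  have E0 : 0 <= E by rewrite addr_ge0// mulr_ge0// expR_ge0.
  apply: (@le_trans _ _ (\int[P n]_x \int[P n]_y (E * expR (h x - h y))%:E)%E); last first.
    rewrite (_ : (\int[P n]_x _)%E = (E%:E * \int[P n]_x \int[P n]_y (expR (h x - h y))%:E)%E).
      by rewrite muleC; apply: lee_wpmul2r => //; exact: IH.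
    rewrite -ge0_integralZl//; last 2 first.
    - exact: (ge0_measurable_fun_integral _ mexph).
    - by move=> x _; exact: integral_ge0.
    apply: eq_integral => x _; under eq_integral do rewrite EFinM.
    rewrite ge0_integralZl//.
    by apply/measurable_EFinP/measurableT_comp => //; exact: measurable_funB.
  apply: ge0_le_integral => //.
  - by move=> x _; rewrite adde_ge0//; exact: integral_ge0.
  - apply: emeasurable_funD.
      apply: (@ge0_measurable_fun_integral _ _ _ _ _ _ (fun z : n.-tuple T * n.-tuple T =>
        (expR (f [tuple of t :: z.1] - f [tuple of s :: z.2]))%:E))%E => //.
      by apply: mphi; measurable_projection.
    apply: (@ge0_measurable_fun_integral _ _ _ _ _ _ (fun z : n.-tuple T * n.-tuple T =>
      (expR (f [tuple of s :: z.1] - f [tuple of t :: z.2]))%:E))%E => //.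
    by apply: mphi; measurable_projection.
  - apply: (@ge0_measurable_fun_integral _ _ _ _ _ _ (fun z : n.-tuple T * n.-tuple T =>
      (E * expR (h z.1 - h z.2))%:E))%E => //.
      apply/measurable_EFinP/measurable_funM => //; exact/measurable_EFinP.
    by move=> z; rewrite lee_fin mulr_ge0// expR_ge0.
  - move=> x _; rewrite -ge0_integralD//; last 2 first.
    + by apply: mphi.
    + by apply: mphi.
    apply: ge0_le_integral => //.
    + by move=> y _; rewrite adde_ge0.
    + by apply: emeasurable_funD; apply: mphi.
    + apply/measurable_EFinP/measurable_funM => //; apply: measurableT_comp => //.
      by apply: measurable_funB.
    + move=> y _; rewrite -EFinD lee_fin.
      pose u := (f [tuple of t :: x] - f [tuple of s :: x]) / 2.
      pose v := (f [tuple of t :: y] - f [tuple of s :: y]) / 2.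
      have -> : f [tuple of t :: x] - f [tuple of s :: y] = (h x - h y) + (u + v).
        by rewrite /h /u /v; field.
      have -> : f [tuple of s :: x] - f [tuple of t :: y] = (h x - h y) - (u + v).
        by rewrite /h /u /v; field.
      rewrite !(expRD (h x - h y)) -mulrDr mulrC ler_wpM2r ?expR_ge0//.
      rewrite /E -!expRD.
      have -> : - c * t + c * s = - (c * t + - c * s) by ring.
      apply: cosh_le.
      have -> : c * t + - c * s = c * (t - s) by ring.
      rewrite normrM (ger0_norm c0).
      apply: le_trans (ler_normD _ _) _.
      rewrite /u /v !normrM (ger0_norm (_ : 0 <= 2^-1))//.
      have := hd x; have := hd y; lra.
have := exchangeable_pair_bound (expR_ge0 _) K0 mK Kb.
by rewrite -expRD -natr1 mulrDl mul1r.
Qed.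

End symmetrized_mgf.

(** * Linear and quadratic forms of a Gaussian vector, and centers of Lipschitz functions *)

Section gaussian_vectors.
Context {R : realType}.
Local Notation N := (@normal_prob R 0 1).
Local Notation T := (measurableTypeR R).
Local Notation P := (prob_power N).

Lemma measurable_tnthR n (i : 'I_n) :
  measurable_fun setT (fun x : n.-tuple T => tnth x i : R).
Proof. exact: measurable_tnth. Qed.

Lemma measurable_linear n (b : 'I_n -> R) :
  measurable_fun setT (fun x : n.-tuple T => \sum_(i < n) b i * tnth x i).
Proof.
apply: measurable_sum => i; apply: measurable_funM => //; exact: measurable_tnthR.
Qed.

(** The sigma-algebra on tuples is generated by the coordinates. The set where f < a is the
    countable union, over rational points q, of the sets where the Lipschitz upper bound f(q) + c |x
    - q|_1 is below a. *)
Lemma measurable_coord_lipschitz n (c : R) (f : n.-tuple T -> R) : 0 <= c ->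
  (forall x y, `|f x - f y| <= c * \sum_(i < n) `|tnth x i - tnth y i|) ->
  measurable_fun setT f.
Proof.
move=> c0 lipf.
apply: (measurability _ (RGenInftyO.measurableE R)) => _ [_ [a ->] <-].
pose q (z : n.-tuple rat) : n.-tuple T := [tuple of map ratr z].
pose A (z : n.-tuple rat) : set (n.-tuple T) :=
  [set x | f (q z) + c * \sum_(i < n) `|tnth x i - tnth (q z) i| < a].
have -> : setT `&` f @^-1` `]-oo, a[ = \bigcup_z A z.
  apply/seteqP; split=> x /=; rewrite in_itv/=.
    move=> [_ xa].
    (* Moving from x to q costs c n e twice, once in f(q) and once in the distance; the 1 keeps the
       divisor positive when c or n is 0. *)
    pose e := (a - f x) / (2 * c * n%:R + 1).
    have D0 : 0 < 2 * c * n%:R + 1 by rewrite ltr_wpDl// !mulr_ge0.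
    have e0 : 0 < e by rewrite divr_gt0// subr_gt0.
    have /choice[z hz] (i : 'I_n) : exists z : rat, `|(tnth x i : R) - ratr z| <= e.
      have /rat_in_itvoo[z] : tnth x i - e < tnth x i + e :> R by lra.
      rewrite in_itv/= => /andP[h1 h2]; exists z.
      by rewrite ler_norml; apply/andP; split; lra.
    exists [tuple z i | i < n] => //; rewrite /A/=.
    set y := q _.
    have S : \sum_(i < n) `|tnth x i - tnth y i| <= e * n%:R.
      rewrite mulr_natr -[n in leRHS]card_ord -sumr_const ler_sum// => i _.
      by rewrite /y /q tnth_map tnth_mktuple.
    have := lipf x y; rewrite ler_norml => /andP[h1 _].
    have h3 : c * \sum_(i < n) `|tnth x i - tnth y i| <= c * (e * n%:R) by rewrite ler_wpM2l.
    have h4 : e * (2 * c * n%:R + 1) = a - f x by rewrite /e divfK// gt_eqF.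
    nra.
  move=> [z _]; rewrite /A/= => h; split=> //.
  have := lipf x (q z); rewrite ler_norml => /andP[_ h1].
  lra.
apply: countable_bigcupT_measurable => [|z]; first exact: countableP.
rewrite -[A z]setTI /A.
apply: (measurable_fun_ltr _ _ measurableT (Y := [set true])) => //.
apply: measurable_funD => //; apply: measurable_funM => //.
apply: measurable_sum => i; apply: measurableT_comp => //.
by apply: measurable_funB => //; exact: measurable_tnthR.
Qed.

Lemma gaussian_linear_mgf n (b : 'I_n -> R) :
  (\int[P n]_x (expR (\sum_(i < n) b i * tnth x i))%:E =
   (expR ((\sum_(i < n) b i ^+ 2) / 2))%:E)%E.
Proof.
under eq_integral do rewrite expR_sum -prodEFin.
rewrite (prob_power_prod N (g := fun i (t : T) => (expR (b i * t))%:E)).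
- by under eq_bigr do rewrite normal_mgf; rewrite prodEFin -expR_sum mulr_suml.
- move=> i; apply/measurable_EFinP/measurableT_comp => //; exact: measurable_funM.
- by move=> i t; rewrite lee_fin expR_ge0.
Qed.

Lemma gaussian_linear_moment2 n (b : 'I_n -> R) (c : R) :
  (\int[P n]_x ((\sum_(i < n) b i * tnth x i + c) ^+ 2)%:E
   <= (\sum_(i < n) b i ^+ 2 + c ^+ 2)%:E)%E.
Proof.
have mf m (b' : 'I_m -> R) c' :
    measurable_fun setT (fun x : m.-tuple T => ((\sum_(i < m) b' i * tnth x i + c') ^+ 2)%:E).
  apply/measurable_EFinP/measurable_funX/measurable_funD => //; exact: measurable_linear.
elim: n b c => [|n IH] b c.
  rewrite integral_prob_power0//; last by move=> x; rewrite lee_fin sqr_ge0.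
  by rewrite !big_ord0 !add0r.
rewrite integral_prob_powerS_swap//; last by move=> x; rewrite lee_fin sqr_ge0.
apply: (@le_trans _ _ (\int[P n]_x ((b ord0 ^+ 2)%:E + ((\sum_(i < n) b (lift ord0 i) * tnth x i + c) ^+ 2)%:E)))%E.
  apply: ge0_le_integral => //.
  - by move=> x _; apply: integral_ge0 => t _; rewrite lee_fin sqr_ge0.
  - apply: (@ge0_measurable_fun_integral _ _ (n.-tuple T) T _ _
      (fun z => ((\sum_(i < n.+1) b i * tnth [tuple of z.2 :: z.1] i + c) ^+ 2)%:E)).
      by apply: (measurableT_comp (mf _ b c)); apply: measurable_cons.
    by move=> z; rewrite lee_fin sqr_ge0.
  - by apply: emeasurable_funD => //; exact: mf.
  - move=> x _; have := normal_quadratic 0 (b ord0) (\sum_(i < n) b (lift ord0 i) * tnth x i + c).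
    rewrite expr0n/= mulr0 add0r EFinD; apply: le_trans.
    rewrite le_eqVlt; apply/orP; left; apply/eqP; apply: eq_integral => t _.
    rewrite big_ord_recl mul0r add0r tnth0 -addrA; congr ((_ + (_ + _)) ^+ 2)%:E.
    by apply: eq_bigr => i _; rewrite tnthS.
rewrite ge0_integralD//; do ?[by move=> x _; rewrite lee_fin sqr_ge0|exact: mf].
rewrite integral_cst//= probability_setT mule1 big_ord_recl -addrA EFinD.
by apply: leeD2l; exact: IH.
Qed.

Lemma measurable_quadratic n (S : 'I_n -> 'I_n -> R) :
  measurable_fun setT (fun x : n.-tuple T => \sum_(i < n) \sum_(j < n) S i j * (tnth x i * tnth x j)).
Proof.
apply: measurable_sum => i; apply: measurable_sum => j; apply: measurable_funM => //.
apply: measurable_funM; exact: measurable_tnthR.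
Qed.

(** As a polynomial in the head t, the centered form is S_00 (t^2 - 1) + l t + Q, with [l] linear
    and [Q] a centered quadratic form in the tail; [normal_quadratic] then gives the induction
    step. *)
Lemma gaussian_quadratic_variance n (S : 'I_n -> 'I_n -> R) :
  (\int[P n]_x ((\sum_(i < n) \sum_(j < n) S i j * (tnth x i * tnth x j) - \sum_(i < n) S i i) ^+ 2)%:E
   <= (600 * \sum_(i < n) \sum_(j < n) S i j ^+ 2)%:E)%E.
Proof.
(* The arithmetic below uses only that the constant is at least 2, since (S_0i + S_i0)^2 <= 2
   (S_0i^2 + S_i0^2). *)
have [k k2 kE] : exists2 k : R, 2 <= k & k = 600 by exists 600 => //; lra.
have k0 : 0 <= k by apply: le_trans k2.
have nq := @normal_quadratic R; rewrite -kE {kE} in nq *.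
have mf m (S' : 'I_m -> 'I_m -> R) : measurable_fun setT (fun x : m.-tuple T =>
    ((\sum_(i < m) \sum_(j < m) S' i j * (tnth x i * tnth x j) - \sum_(i < m) S' i i) ^+ 2)%:E).
  apply/measurable_EFinP/measurable_funX/measurable_funB => //; exact: measurable_quadratic.
elim: n S => [|n IH] S.
  rewrite integral_prob_power0//; last by move=> x; rewrite lee_fin sqr_ge0.
  by rewrite !big_ord0 subrr expr0n/= mulr0.
rewrite integral_prob_powerS_swap//; last by move=> x; rewrite lee_fin sqr_ge0.
pose S' i j := S (lift ord0 i) (lift ord0 j).
pose b j := S ord0 (lift ord0 j) + S (lift ord0 j) ord0.
pose Q (x : n.-tuple T) := \sum_(i < n) \sum_(j < n) S' i j * (tnth x i * tnth x j) - \sum_(i < n) S' i i.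
pose l (x : n.-tuple T) := \sum_(i < n) b i * tnth x i + 0.
apply: (@le_trans _ _ (\int[P n]_x ((k * S ord0 ord0 ^+ 2)%:E + (((l x) ^+ 2)%:E + ((Q x) ^+ 2)%:E))))%E.
  apply: ge0_le_integral => //.
  - by move=> x _; apply: integral_ge0 => t _; rewrite lee_fin sqr_ge0.
  - apply: (@ge0_measurable_fun_integral _ _ (n.-tuple T) T _ _
      (fun z => ((\sum_(i < n.+1) \sum_(j < n.+1) S i j * (tnth [tuple of z.2 :: z.1] i * tnth [tuple of z.2 :: z.1] j) - \sum_(i < n.+1) S i i) ^+ 2)%:E)).
      by apply: (measurableT_comp (mf _ S)); apply: measurable_cons.
    by move=> z; rewrite lee_fin sqr_ge0.
  - apply: emeasurable_funD => //; apply: emeasurable_funD; last exact: mf.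
    apply/measurable_EFinP/measurable_funX/measurable_funD => //; exact: measurable_linear.
  - move=> x _; have := nq (S ord0 ord0) (l x) (Q x).
    rewrite -addrA !EFinD; apply: le_trans.
    rewrite le_eqVlt; apply/orP; left; apply/eqP; apply: eq_integral => t _.
    congr (_ ^+ 2)%:E.
    rewrite !big_ord_recl /= tnth0.
    under eq_bigr do rewrite tnthS.
    under [X in _ + _ + X - _]eq_bigr => i _.
      rewrite big_ord_recl tnthS tnth0.
      under eq_bigr do rewrite tnthS.
      over.
    rewrite big_split/= /Q /l /b addr0 mulr_suml.
    have -> : \sum_(i < n) (S ord0 (lift ord0 i) + S (lift ord0 i) ord0) * tnth x i * t =
       \sum_(i < n) S ord0 (lift ord0 i) * (t * tnth x i) + \sum_(i < n) S (lift ord0 i) ord0 * (tnth x i * t).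
      by rewrite -big_split; apply: eq_bigr => i _ /=; ring.
    rewrite /S'; ring.
have m1 : measurable_fun setT (fun x => ((l x) ^+ 2)%:E).
  by apply/measurable_EFinP/measurable_funX/measurable_funD => //; exact: measurable_linear.
have m2 : measurable_fun setT (fun x => ((Q x) ^+ 2)%:E) by exact: mf.
have h1 : (\int[P n]_x ((l x) ^+ 2)%:E <= _)%E := gaussian_linear_moment2 b 0.
have h2 : (\int[P n]_x ((Q x) ^+ 2)%:E <= _)%E := IH S'.
clearbody Q l.
rewrite ge0_integralD//; do ?[exact: emeasurable_funD
  | by move=> x _; rewrite adde_ge0// lee_fin sqr_ge0
  | by move=> x _; rewrite lee_fin mulr_ge0// sqr_ge0].
rewrite integral_cst//= probability_setT mule1.
rewrite ge0_integralD//; do ?[by move=> x _; rewrite lee_fin sqr_ge0].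
apply: (le_trans (leeD2l _ (leeD h1 h2))).
rewrite -!EFinD lee_fin expr0n/= addr0.
rewrite !big_ord_recl.
under [X in _ <= _ * (_ + X)]eq_bigr do rewrite big_ord_recl.
rewrite big_split/=.
have : \sum_(i < n) b i ^+ 2 <= 2 * (\sum_(i < n) S ord0 (lift ord0 i) ^+ 2 + \sum_(i < n) S (lift ord0 i) ord0 ^+ 2).
  rewrite -big_split mulr_sumr; apply: ler_sum => i _ /=; rewrite /b.
  by have := sqr_ge0 (S ord0 (lift ord0 i) - S (lift ord0 i) ord0); nra.
set B := \sum_(i < n) b i ^+ 2; set B1 := \sum_(i < n) _; set B2 := \sum_(i < n) _.
have B10 : 0 <= B1 by apply: sumr_ge0 => i _; exact: sqr_ge0.
have B20 : 0 <= B2 by apply: sumr_ge0 => i _; exact: sqr_ge0.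
rewrite /S'; nra.
Qed.

(** By the symmetrized bound, used in both orders, the average over y of the left side is at most 2
    exp(n c^2), so some y does not exceed this by more than 1. The slack 1 makes the contradiction
    strict. *)
Lemma exists_center n (c : R) (f : n.-tuple T -> R) : 0 <= c ->
  (forall x y, `|f x - f y| <= c * \sum_(i < n) `|tnth x i - tnth y i|) ->
  exists y, (\int[P n]_x (expR (f x - f y) + expR (f y - f x))%:E
    <= (2 * expR (n%:R * c ^+ 2) + 1)%:E)%E.
Proof.
move=> c0 lipf; have mf := measurable_coord_lipschitz c0 lipf.
set C := 2 * expR _.
apply: contrapT => /forallNP h.
have mF : measurable_fun setT (fun z : n.-tuple T * n.-tuple T => (expR (f z.1 - f z.2))%:E).
  apply/measurable_EFinP/measurableT_comp => //.
  by apply: measurable_funB; apply: measurableT_comp.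
have mG : measurable_fun setT (fun z : n.-tuple T * n.-tuple T => (expR (f z.2 - f z.1))%:E).
  apply/measurable_EFinP/measurableT_comp => //.
  by apply: measurable_funB; apply: measurableT_comp.
have e0 z : (0 <= (expR z)%:E :> \bar R)%E by rewrite lee_fin expR_ge0.
have mF1 : measurable_fun setT (fun y => \int[P n]_x (expR (f x - f y))%:E)%E.
  by apply: (@ge0_measurable_fun_integral _ _ (n.-tuple T) (n.-tuple T) _ _ (fun z => (expR (f z.2 - f z.1))%:E)).
have mF2 : measurable_fun setT (fun y => \int[P n]_x (expR (f y - f x))%:E)%E.
  by apply: (@ge0_measurable_fun_integral _ _ (n.-tuple T) (n.-tuple T) _ _ (fun z => (expR (f z.1 - f z.2))%:E)).
have key := symmetrized_mgf_coord_lipschitz c0 mf lipf.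
have : ((C + 1)%:E <= \int[P n]_y (\int[P n]_x (expR (f x - f y))%:E + \int[P n]_x (expR (f y - f x))%:E))%E.
  rewrite -[leLHS]mule1 -(probability_setT (P n)) -integral_cst//.
  apply: ge0_le_integral => //.
  - by move=> x _; rewrite lee_fin addr_ge0// mulr_ge0// expR_ge0.
  - exact: emeasurable_funD.
  - move=> y _; have /negP := h y; rewrite -ltNge => /ltW /le_trans; apply.
    rewrite le_eqVlt; apply/orP; left; apply/eqP.
    under eq_integral do rewrite EFinD.
    by rewrite ge0_integralD//; apply/measurable_EFinP/measurableT_comp => //; exact: measurable_funB.
rewrite ge0_integralD//; do ?[by move=> x _; exact: integral_ge0].
rewrite [X in (_ <= X + _)%E](_ : _ = \int[P n]_x \int[P n]_y (expR (f x - f y))%:E)%E; last first.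
  by rewrite (fubini_tonelli (fun z : n.-tuple T * n.-tuple T => (expR (f z.1 - f z.2))%:E)).
move=> /le_trans /(_ (leeD key key)).
by rewrite -EFinD lee_fin /C; lra.
Qed.

End gaussian_vectors.

(** * Transfer from the probability space to the product Gaussian measure *)

Section gaussian_law.
Context {R : realType} d (Omega : measurableType d) (P : probability Omega R).
Local Notation N := (@normal_prob R 0 1).
Local Notation T := (measurableTypeR R).

Definition tuple_of_cV n (v : 'cV[R]_n) : n.-tuple T := [tuple v i ord0 | i < n].

Lemma measurable_tuple_of_cV n (V : Omega -> 'cV[R]_n) (s : R) :
  isotropic_gaussian P s V -> measurable_fun setT (fun w => tuple_of_cV (V w)).
Proof.
move=> [mV _]; apply/measurable_fun_tnthP => i.
rewrite (_ : _ \o _ = component V i); first exact: mV.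
by apply/funext => w; rewrite /= tnth_mktuple.
Qed.

Lemma integral_gaussian_vector n (V : Omega -> 'cV[R]_n) (F : n.-tuple T -> \bar R) :
  isotropic_gaussian P 1 V -> measurable_fun setT F -> (forall x, 0 <= F x)%E ->
  (\int[P]_w F (tuple_of_cV (V w)) = \int[prob_power N n]_x F x)%E.
Proof.
move=> gV mF F0.
have mX := measurable_tuple_of_cV gV.
pose X : {mfun Omega >-> n.-tuple T} :=
  HB.pack (fun w => tuple_of_cV (V w)) (isMeasurableFun.Build _ _ _ _ _ mX).
rewrite -[LHS](@ge0_integral_distribution _ _ _ _ _ P X F)//.
apply: eq_measure_integral => A mA _.
apply: (prob_power_unique (N := N) (m := distribution P X)) => // B mB.
rewrite /= /distribution /pushforward/=.
rewrite -(proj2 gV B mB); congr (P _); apply/seteqP; split=> w /= h i;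
  by have := h i; rewrite /tuple_of_cV tnth_mktuple.
Qed.

Lemma isotropic_gaussian_scale n (V : Omega -> 'cV[R]_n) (s : R) : 0 < s ->
  isotropic_gaussian P s V -> isotropic_gaussian P 1 (fun w => s^-1 *: V w).
Proof.
move=> s0 [mV boxV]; split=> [i|B mB].
  rewrite (_ : component _ i = fun w => s^-1 * component V i w).
    by apply: measurable_funM.
  by apply/funext => w; rewrite /component mxE.
have mB' i : measurable [set t | B i (t / s)].
  rewrite -[X in measurable X]setTI.
  have md : measurable_fun [set: R] (fun t : R => t / s) by exact: measurable_funM.
  exact: md.
have := boxV _ mB'.
under [X in _ = X -> _]eq_bigr do rewrite normal_prob_scale//.
move=> <-; congr (P _); apply/seteqP; split=> w /= h i; have := h i;
  by rewrite /component mxE mulrC.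
Qed.

End gaussian_law.

(** * The atomic norm of the extended design *)

Section dot_product.
Context {R : realType}.

Definition dot n (u v : 'cV[R]_n) : R := \sum_(i < n) u i ord0 * v i ord0.

Lemma dotC n (u v : 'cV[R]_n) : dot u v = dot v u.
Proof. by apply: eq_bigr => i _; rewrite mulrC. Qed.

Lemma dotDl n (u v w : 'cV[R]_n) : dot (u + v) w = dot u w + dot v w.
Proof. by rewrite -big_split; apply: eq_bigr => i _; rewrite mxE mulrDl. Qed.

Lemma dotZl n a (u v : 'cV[R]_n) : dot (a *: u) v = a * dot u v.
Proof. by rewrite mulr_sumr; apply: eq_bigr => i _; rewrite mxE mulrA. Qed.

Lemma dotNl n (u v : 'cV[R]_n) : dot (- u) v = - dot u v.
Proof. by rewrite -scaleN1r dotZl mulN1r. Qed.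

Lemma dotDr n (u v w : 'cV[R]_n) : dot w (u + v) = dot w u + dot w v.
Proof. by rewrite !(dotC w) dotDl. Qed.

Lemma dotZr n a (u v : 'cV[R]_n) : dot v (a *: u) = a * dot v u.
Proof. by rewrite !(dotC v) dotZl. Qed.

Lemma dotNr n (u v : 'cV[R]_n) : dot v (- u) = - dot v u.
Proof. by rewrite !(dotC v) dotNl. Qed.

Lemma dot_ge0 n (u : 'cV[R]_n) : 0 <= dot u u.
Proof. by apply: sumr_ge0 => i _; rewrite -expr2 sqr_ge0. Qed.

Lemma dot_mulmx n q (A : 'M[R]_(n, q)) (b : 'cV[R]_q) (v : 'cV[R]_n) :
  dot (A *m b) v = \sum_(j < q) b j ord0 * dot (col j A) v.
Proof.
rewrite /dot; under eq_bigr => i _ do rewrite mxE mulr_suml.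
rewrite exchange_big /=; apply: eq_bigr => j _; rewrite mulr_sumr.
by apply: eq_bigr => i _; rewrite mxE; ring.
Qed.

Lemma sqr_l2norm n (u : 'cV[R]_n) : l2norm u ^+ 2 = dot u u.
Proof.
rewrite /l2norm sqr_sqrtr; first by apply: eq_bigr => i _; rewrite expr2.
by apply: sumr_ge0 => i _; rewrite sqr_ge0.
Qed.

Lemma l2norm_ge0 n (u : 'cV[R]_n) : 0 <= l2norm u.
Proof. exact: sqrtr_ge0. Qed.

Lemma l2normZ n a (u : 'cV[R]_n) : l2norm (a *: u) = `|a| * l2norm u.
Proof.
apply/eqP; rewrite -(@eqrXn2 _ 2)//.
- by rewrite sqr_l2norm exprMn sqr_l2norm dotZl dotZr mulrA -expr2 real_normK ?num_real.
- exact: l2norm_ge0.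
- by rewrite mulr_ge0// l2norm_ge0.
Qed.

Lemma dot_eq0 n (u : 'cV[R]_n) : dot u u = 0 -> u = 0.
Proof.
move=> u0; apply/colP => i; rewrite mxE; apply/eqP; rewrite -sqrf_eq0; apply/eqP.
have := psumr_eq0P (fun i _ => sqr_ge0 (u i ord0)) (_ : \sum_(i < n) u i ord0 ^+ 2 = 0).
by apply => //; rewrite -[RHS]u0; apply: eq_bigr => j _; rewrite expr2.
Qed.

Lemma cauchy_schwarz n (u v : 'cV[R]_n) : `|dot u v| <= l2norm u * l2norm v.
Proof.
rewrite -(@ler_pXn2r _ 2)// ?nnegrE ?mulr_ge0 ?l2norm_ge0//.
rewrite real_normK ?num_real// exprMn !sqr_l2norm.
have [v0|v0] := eqVneq (dot v v) 0.
  by rewrite (dot_eq0 v0) -(scale0r 0) !dotZr !mul0r mulr0 expr0n.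
have vp : 0 < dot v v by rewrite lt0r v0 dot_ge0.
have := dot_ge0 (dot v v *: u - dot u v *: v).
rewrite !(dotDl, dotDr, dotZl, dotZr, dotNl, dotNr) (dotC v u).
set d := dot u v; set a := dot u u; set b := dot v v.
rewrite (_ : _ + _ = b * (a * b - d ^+ 2)); last by ring.
by rewrite pmulr_rge0 ?subr_ge0.
Qed.

Lemma l1norm_ge0 n (u : 'cV[R]_n) : 0 <= l1norm u.
Proof. exact: sumr_ge0. Qed.

Lemma l1normD n (u v : 'cV[R]_n) : l1norm (u + v) <= l1norm u + l1norm v.
Proof. by rewrite -big_split; apply: ler_sum => i _; rewrite mxE ler_normD. Qed.

Lemma l1normZ n a (u : 'cV[R]_n) : l1norm (a *: u) = `|a| * l1norm u.
Proof. by rewrite mulr_sumr; apply: eq_bigr => i _; rewrite mxE normrM. Qed.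

Lemma l1norm_col_mx n m (u : 'cV[R]_n) (v : 'cV[R]_m) :
  l1norm (col_mx u v) = l1norm u + l1norm v.
Proof.
rewrite /l1norm big_split_ord /=; congr (_ + _); apply: eq_bigr => i _.
  by rewrite col_mxEu.
by rewrite col_mxEd.
Qed.

Lemma dot_mulmx_le n q (A : 'M[R]_(n, q)) (b : 'cV[R]_q) (v : 'cV[R]_n) K :
  (forall j, `|dot (col j A) v| <= K) -> `|dot (A *m b) v| <= l1norm b * K.
Proof.
move=> hK; rewrite dot_mulmx /l1norm mulr_suml.
apply: le_trans (ler_norm_sum _ _ _) _; apply: ler_sum => j _.
by rewrite normrM ler_wpM2l.
Qed.

End dot_product.

Section atomic_norm.
Context {R : realType} {n p : nat} (X : 'M[R]_(n, p)).
Hypotheses (n_gt0 : (0 < n)%N) (X_neq0 : X != 0).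

Local Notation kappa := (Num.sqrt n%:R * gamma X).
Local Notation A := (Xtilde X).

(** An infimum is defined whether or not it is attained; where the procedure supplies a minimum,
    [is_min_l1_atomic] identifies the two. *)
Definition atomic_norm (x : 'cV[R]_n) : R :=
  inf [set l1norm b | b in [set b : 'cV[R]_(p + n) | x = A *m b]].

Let sqrtn_gt0 : 0 < Num.sqrt n%:R :> R.
Proof. by rewrite sqrtr_gt0 ltr0n. Qed.

Lemma l2norm_col_le j : l2norm (col j X) <= kappa.
Proof.
rewrite mulrC -ler_pdivrMr// /gamma.
exact: (le_bigmax _ (fun j => l2norm (col j X) / Num.sqrt n%:R)).
Qed.

Lemma gamma_gt0 : 0 < gamma X.
Proof.
have [i [j Xij]] : exists i j, X i j != 0.
  apply: contrapT => h; move/negP: X_neq0; apply; apply/eqP/matrixP => i j.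
  rewrite mxE; apply: contrapT => /eqP Xij; apply: h; by exists i, j.
suff : 0 < kappa by rewrite pmulr_rgt0.
apply: lt_le_trans (l2norm_col_le j).
rewrite sqrtr_gt0 (bigD1 i)//= ltr_wpDr//.
  by apply: sumr_ge0 => k _; rewrite sqr_ge0.
by rewrite mxE exprn_even_gt0.
Qed.

Let kappa_gt0 : 0 < kappa.
Proof. by rewrite mulr_gt0// gamma_gt0. Qed.

Lemma l2norm_col_Xtilde_le j : l2norm (col j A) <= kappa.
Proof.
rewrite /Xtilde; case: (split_ordP j) => k ->.
  rewrite (_ : col _ _ = col k X) ?l2norm_col_le//.
  by apply/colP => i; rewrite mxE row_mxEl mxE.
rewrite (_ : col _ _ = kappa *: delta_mx k ord0); last first.
  by apply/colP => i; rewrite mxE row_mxEr !mxE eqxx andbT.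
rewrite l2normZ gtr0_norm// -[leRHS]mulr1 ler_wpM2l ?(ltW kappa_gt0)//.
rewrite /l2norm -sqrtr1 ler_wsqrtr// (bigD1 k)//= mxE !eqxx expr1n big1 ?addr0// => i ik.
by rewrite mxE (negbTE ik) expr0n.
Qed.

Lemma Xtilde_col_mx0 (b : 'cV[R]_p) : A *m col_mx b 0 = X *m b.
Proof. by rewrite /Xtilde mul_row_col mulmx0 addr0. Qed.

Lemma Xtilde_0col_mx (x : 'cV[R]_n) : A *m col_mx 0 (kappa^-1 *: x) = x.
Proof.
rewrite /Xtilde mul_row_col mulmx0 add0r -scalemxAl mul1mx scalerA.
by rewrite divff ?scale1r// gt_eqF.
Qed.

(** The identity block makes every system solvable, since gamma is positive. *)
Lemma has_inf_atomic x :
  has_inf [set l1norm b | b in [set b : 'cV[R]_(p + n) | x = A *m b]].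
Proof.
split; last by exists 0 => _ [b _ <-]; exact: l1norm_ge0.
by exists (l1norm (col_mx (0 : 'cV[R]_p) (kappa^-1 *: x))); exists (col_mx 0 (kappa^-1 *: x)) => //=; rewrite Xtilde_0col_mx.
Qed.

Lemma atomic_norm_le b : atomic_norm (A *m b) <= l1norm b.
Proof. by apply: ge_inf; [exact: (has_inf_atomic _).2|exists b]. Qed.

Lemma le_atomic_norm x m : (forall b, x = A *m b -> m <= l1norm b) -> m <= atomic_norm x.
Proof.
move=> h; apply: lb_le_inf; first exact: (has_inf_atomic _).1.
by move=> _ [b xb <-]; exact: h.
Qed.

Lemma atomic_norm_ge0 x : 0 <= atomic_norm x.
Proof. by apply: le_atomic_norm => b _; exact: l1norm_ge0. Qed.

Lemma is_min_l1_atomic x M : is_min_l1 A x M -> M = atomic_norm x.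
Proof.
move=> [[b xb <-] lb]; apply/eqP; rewrite eq_le; apply/andP; split.
  by apply: le_atomic_norm => b' xb'; apply: lb; exists b'.
by rewrite xb; exact: atomic_norm_le.
Qed.

Lemma atomic_normD x b : atomic_norm (x + A *m b) <= atomic_norm x + l1norm b.
Proof.
rewrite -lerBlDr; apply: le_atomic_norm => b' ->.
rewrite -mulmxDr lerBlDr; apply: le_trans (atomic_norm_le _) _; exact: l1normD.
Qed.

(** With [b] supported in the block of X, this removes the signal X beta_0; in the identity block,
    it gives the Lipschitz bound. *)
Lemma atomic_normB_le x b : `|atomic_norm (x + A *m b) - atomic_norm x| <= l1norm b.
Proof.
rewrite ler_norml; apply/andP; split; last by rewrite lerBlDl atomic_normD.
have := atomic_normD (x + A *m b) (- b); rewrite mulmxN addrK.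
by rewrite -scaleN1r l1normZ normrN1 mul1r; lra.
Qed.

Lemma atomic_normZ a x : 0 < a -> atomic_norm (a *: x) = a * atomic_norm x.
Proof.
suff h c u : 0 < c -> c * atomic_norm u <= atomic_norm (c *: u).
  move=> a0; apply/eqP; rewrite eq_le h// andbT.
  have := h a^-1 (a *: x); rewrite invr_gt0 => /(_ a0).
  by rewrite scalerA mulVf ?gt_eqF// scale1r -ler_pdivlMl ?invr_gt0// invrK.
move=> c0; apply: le_atomic_norm => b cub.
have -> : u = A *m (c^-1 *: b).
  by rewrite -scalemxAr -cub scalerA mulVf ?gt_eqF// scale1r.
apply: le_trans (ler_wpM2l (ltW c0) (atomic_norm_le _)) _.
by rewrite l1normZ gtr0_norm ?invr_gt0// mulVKf ?gt_eqF.
Qed.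

Lemma atomic_norm_lipschitz x y :
  `|atomic_norm x - atomic_norm y| <= kappa^-1 * l1norm (x - y).
Proof.
have xE : x = y + A *m col_mx 0 (kappa^-1 *: (x - y)).
  by rewrite Xtilde_0col_mx addrCA subrr addr0.
rewrite {1}xE; apply: le_trans (atomic_normB_le _ _) _.
rewrite l1norm_col_mx l1normZ gtr0_norm ?invr_gt0//.
have -> : l1norm (0 : 'cV[R]_p) = 0 by rewrite /l1norm big1// => i _; rewrite mxE normr0.
by rewrite add0r.
Qed.

(** Duality: x = A b gives |x|^2 as the sum of the b_j <a_j, x>, which is at most |b|_1 K for every
    representation b. *)
Lemma sqr_l2norm_le_atomic x (K : R) :
  (forall j, `|dot (col j A) x| <= K) -> l2norm x ^+ 2 <= K * atomic_norm x.
Proof.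
move=> hK.
have [j0 _] : exists j : 'I_(p + n), True.
  by exists (rshift p (Ordinal n_gt0)).
have K0 : 0 <= K := le_trans (normr_ge0 _) (hK j0).
move: K0; rewrite le_eqVlt => /predU1P[K0|K0].
  have [_ [b xb _]] := (has_inf_atomic x).1.
  rewrite -K0 mul0r sqr_l2norm {1}xb.
  apply: le_trans (ler_norm _) _; apply: le_trans (dot_mulmx_le _ hK) _.
  by rewrite -K0 mulr0.
rewrite mulrC -ler_pdivrMr//; apply: le_atomic_norm => b xb.
rewrite ler_pdivrMr// sqr_l2norm {1}xb.
by apply: le_trans (ler_norm _) _; exact: dot_mulmx_le.
Qed.

(** The duality bound with Cauchy-Schwarz in place of the maximum over columns; it is the crude
    bound used where |z| is small. *)
Lemma l2norm_le_atomic x : l2norm x <= kappa * atomic_norm x.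
Proof.
have [x0|x0] := eqVneq (l2norm x) 0.
  by rewrite x0 mulr_ge0 ?atomic_norm_ge0// ltW.
have xp : 0 < l2norm x by rewrite lt0r x0 l2norm_ge0.
rewrite -(ler_pM2l xp) -expr2 mulrA [l2norm x * _]mulrC.
apply: sqr_l2norm_le_atomic => j.
apply: le_trans (cauchy_schwarz _ _) _.
by rewrite ler_wpM2r ?l2norm_col_Xtilde_le// ltW.
Qed.

End atomic_norm.

(** * Deterministic bounds *)

Section pointwise_bounds.
Context {R : realType}.
Implicit Types (n : nat).

Lemma exprn4 (x : R) : x ^+ 4 = (x ^+ 2) ^+ 2.
Proof. by rewrite -exprM. Qed.

Lemma expR_ge_pow4 (x : R) : 0 <= x -> (x / 4) ^+ 4 <= expR x.
Proof.
move=> x0; have -> : expR x = expR (x / 4) ^+ 4 by rewrite -expRM_natl; congr expR; field.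
have h := expR_ge1Dx (x / 4).
by rewrite lerXn2r ?nnegrE ?divr_ge0 ?expR_ge0//; lra.
Qed.

Lemma pow4_le_cosh (y : R) : y ^+ 4 <= 256 * (expR y + expR (- y)).
Proof.
have h0 := expR_ge0 y; have h1 := expR_ge0 (- y).
have e4 (z : R) : (z / 4) ^+ 4 = z ^+ 4 / 256 by field.
have [y0|y0] := leP 0 y.
  by have := expR_ge_pow4 y0; rewrite e4; lra.
have ny0 : 0 <= - y by lra.
have := expR_ge_pow4 ny0; rewrite e4 (_ : (- y) ^+ 4 = y ^+ 4); last by ring.
lra.
Qed.

Lemma pow4_add (x y : R) : (x + y) ^+ 4 <= 8 * (x ^+ 4 + y ^+ 4).
Proof.
have h1 := sqr_ge0 (x ^+ 2 - y ^+ 2); have h2 := sqr_ge0 (x - y).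
have -> : (x + y) ^+ 4 = ((x + y) ^+ 2) ^+ 2 by rewrite -exprM.
have s1 : (x + y) ^+ 2 <= 2 * (x ^+ 2 + y ^+ 2) by nra.
have s2 : ((x + y) ^+ 2) ^+ 2 <= (2 * (x ^+ 2 + y ^+ 2)) ^+ 2.
  have S0 : 0 <= (x + y) ^+ 2 by exact: sqr_ge0.
  by rewrite lerXn2r// nnegrE; lra.
apply: le_trans s2 _.
have -> : 8 * (x ^+ 4 + y ^+ 4) = (2 * (x ^+ 2 + y ^+ 2)) ^+ 2 + 4 * (x ^+ 2 - y ^+ 2) ^+ 2 by ring.
lra.
Qed.

(* [L] is the logarithm of the number [exp L] of Gaussian variables [g];
   [t] is an exponential sum of all of them, normalised by [exp (2 L)]. *)
Lemma pow4_max_bound (L g t : R) : 1 <= L ->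
  expR (Num.sqrt L * g) + expR (- (Num.sqrt L * g)) <= expR (2 * L) * t ->
  g ^+ 4 <= L ^+ 2 * (128 + 2048 * t).
Proof.
move=> L1 ht; set y := Num.sqrt L * g in ht.
have L0 : 0 <= L by lra.
have y4 : y ^+ 4 = L ^+ 2 * g ^+ 4.
  by rewrite /y exprMn (exprn4 (Num.sqrt L)) sqr_sqrtr.
have hy : expR `|y| <= expR (2 * L) * t.
  have e0 := expR_ge0 y; have e1 := expR_ge0 (- y).
  have [y0|y0] := leP 0 y; first by rewrite ger0_norm//; lra.
  by rewrite ltr0_norm//; lra.
have t0 : 0 <= t.
  by rewrite -(pmulr_rge0 _ (expR_gt0 (2 * L))) (le_trans _ hy)// expR_ge0.
have y4n : y ^+ 4 = `|y| ^+ 4.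
  by rewrite !exprn4 real_normK ?num_real.
have L2 : 1 <= L ^+ 2 by rewrite exprn_ege1.
suff : y ^+ 4 <= L ^+ 2 * (L ^+ 2 * (128 + 2048 * t)).
  by rewrite y4 ler_pM2l//; lra.
(* Beyond 2 L the excess [d] satisfies exp(d) <= t. The constants are 128 = 8 * 16 and 2048 = 8 *
   256, from [pow4_add], (2 L)^4 and [expR_ge_pow4]. *)
have [yL|yL] := leP `|y| (2 * L).
  rewrite y4n; apply: (@le_trans _ _ ((2 * L) ^+ 4)); first by rewrite lerXn2r ?nnegrE//; lra.
  have -> : (2 * L) ^+ 4 = L ^+ 2 * (L ^+ 2 * 16) by ring.
  by rewrite !ler_pM2l; lra.
have h : expR (`|y| - 2 * L) <= t.
  by rewrite expRD expRN -ler_pdivlMr ?invr_gt0 ?expR_gt0// invrK mulrC.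
have d0 : 0 <= `|y| - 2 * L by lra.
have := expR_ge_pow4 d0; set d := `|y| - 2 * L in h d0 *.
rewrite (_ : (d / 4) ^+ 4 = d ^+ 4 / 256); last by field.
move=> h'.
have := pow4_add (2 * L) d; rewrite (_ : 2 * L + d = `|y|); last by rewrite /d; ring.
rewrite -y4n => h''; apply: le_trans h'' _.
have -> : (2 * L) ^+ 4 = L ^+ 2 * (L ^+ 2 * 16) by ring.
have LL : 1 <= L ^+ 2 * L ^+ 2 by nra.
have h3 : t <= L ^+ 2 * L ^+ 2 * t by rewrite ler_peMl.
have -> : L ^+ 2 * (L ^+ 2 * (128 + 2048 * t)) =
  128 * (L ^+ 2 * L ^+ 2) + 2048 * (L ^+ 2 * L ^+ 2 * t) by ring.
have -> : L ^+ 2 * (L ^+ 2 * 16) = 16 * (L ^+ 2 * L ^+ 2) by ring.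
lra.
Qed.

(** The fourth root of q is replaced by the larger 1 + q, which keeps the bound affine in the error
    variable. *)
Lemma le_sqrt_of_pow4 (L g q : R) : 1 <= L -> 0 <= q ->
  g ^+ 4 <= L ^+ 2 * q -> `|g| <= Num.sqrt L * (1 + q).
Proof.
move=> L1 q0 h.
rewrite -(@ler_pXn2r _ 4)// ?nnegrE ?mulr_ge0 ?sqrtr_ge0//; last lra.
rewrite (exprn4 `|g|) real_normK ?num_real// -exprn4.
apply: (le_trans h).
rewrite exprMn (exprn4 (Num.sqrt L)) sqr_sqrtr; last lra.
rewrite ler_pM2l; last by rewrite exprn_gt0//; lra.
have -> : (1 + q) ^+ 4 = q + (1 + 3 * q + 6 * q ^+ 2 + 4 * q ^+ 3 + q ^+ 4) by ring.
rewrite lerDl !addr_ge0// ?mulr_ge0// ?exprn_ge0//.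
Qed.

(** The numerator M - G is split through F and the center m. Each product of a square with G^-2 is
    separated by AM-GM, weighted so that G^-4 enters at the scale g^4 rho^2 on which it is
    controlled; the result is affine in H and in the fourth powers. *)
Lemma ratio_sqr_bound (M F G m b g rho H : R) : 0 < G -> 0 < g -> 0 < rho ->
  `|M - F| <= b -> G ^- 4 <= H * (g ^+ 4 * rho ^+ 2) ->
  (M / G - 1) ^+ 2 <= ((b * g) ^+ 2 * rho + rho) *
    (3 / 2 * (1 + 3 * H + (g * (F - m)) ^+ 4 + (g * (G - m)) ^+ 4)).
Proof.
move=> G0 g0 rho0 MF hH.
pose I := G^-1; have I0 : 0 < I by rewrite invr_gt0.
have I4 : I ^+ 4 <= H * (g ^+ 4 * rho ^+ 2) by rewrite /I exprVn.
have D0 : 0 < g ^+ 4 * rho ^+ 2 by rewrite mulr_gt0 ?exprn_gt0.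
have H0 : 0 <= H by rewrite -(pmulr_lge0 _ D0) (le_trans _ I4)// exprn_ge0// ltW.
have -> : M / G - 1 = ((M - F) + (F - m) - (G - m)) * I.
  by rewrite /I; field; rewrite gt_eqF.
set x := M - F in MF *; set y := F - m; set z := G - m.
have xb : x ^+ 2 <= b ^+ 2.
  by rewrite -[x ^+ 2]real_normK ?num_real// lerXn2r ?nnegrE// (le_trans _ MF).
have s3 : (x + y - z) ^+ 2 <= 3 * (x ^+ 2 + y ^+ 2 + z ^+ 2).
  have := sqr_ge0 (x - y); have := sqr_ge0 (x + z); have := sqr_ge0 (y + z); nra.
have I2 : 0 <= I ^+ 2 by exact: sqr_ge0.
have b1 : 2 * I ^+ 2 <= g ^+ 2 * rho * (1 + H).
  have q0 : 0 < g ^+ 2 * rho by rewrite mulr_gt0 ?exprn_gt0.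
  rewrite -(ler_pM2l q0).
  have := sqr_ge0 (g ^+ 2 * rho - I ^+ 2).
  have -> : (g ^+ 2 * rho - I ^+ 2) ^+ 2 = (g ^+ 4 * rho ^+ 2) - (g ^+ 2 * rho) * (2 * I ^+ 2) + I ^+ 4 by ring.
  have -> : (g ^+ 2 * rho) * (g ^+ 2 * rho * (1 + H)) = g ^+ 4 * rho ^+ 2 + H * (g ^+ 4 * rho ^+ 2) by ring.
  lra.
have b2 u : 2 * (u ^+ 2 * I ^+ 2) <= rho * ((g * u) ^+ 4 + H).
  have q0 : 0 < g ^+ 4 * rho by rewrite mulr_gt0 ?exprn_gt0.
  rewrite -(ler_pM2l q0).
  have := sqr_ge0 (g ^+ 4 * rho * u ^+ 2 - I ^+ 2).
  have -> : (g ^+ 4 * rho * u ^+ 2 - I ^+ 2) ^+ 2 = g ^+ 4 * rho * (rho * (g * u) ^+ 4) - g ^+ 4 * rho * (2 * (u ^+ 2 * I ^+ 2)) + I ^+ 4 by ring.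
  have -> : g ^+ 4 * rho * (rho * ((g * u) ^+ 4 + H)) = g ^+ 4 * rho * (rho * (g * u) ^+ 4) + H * (g ^+ 4 * rho ^+ 2) by ring.
  lra.
rewrite exprMn.
apply: (@le_trans _ _ (3 * (b ^+ 2 * I ^+ 2 + y ^+ 2 * I ^+ 2 + z ^+ 2 * I ^+ 2))).
  have := ler_wpM2r I2 xb; have := ler_wpM2r I2 s3.
  set X := (x + y - z) ^+ 2; lra.
have hy := b2 y; have hz := b2 z.
set Y := (g * y) ^+ 4 in hy *; set Z := (g * z) ^+ 4 in hz *.
have Y0 : 0 <= Y by rewrite exprn_even_ge0.
have Z0 : 0 <= Z by rewrite exprn_even_ge0.
have hb : 2 * (b ^+ 2 * I ^+ 2) <= (b * g) ^+ 2 * rho * (1 + H).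
  rewrite mulrCA; apply: (le_trans (ler_wpM2l (sqr_ge0 b) b1)).
  by rewrite le_eqVlt; apply/orP; left; apply/eqP; ring.
set r2 := (b * g) ^+ 2 * rho in hb *.
have r20 : 0 <= r2 by rewrite mulr_ge0 ?sqr_ge0// ltW.
have hh : 0 <= r2 * (2 * H + Y + Z) by apply: mulr_ge0 => //; lra.
have hh' : 0 <= rho * (1 + H) by apply: mulr_ge0; lra.
lra.
Qed.

(* If [l2norm z ^+ 2 >= c n], duality bounds [G] below.  Otherwise the AM-GM
   inequality makes the product of the [w i], which dominate
   [|z_i|^(-1/2)], exponentially large, and the crude bound on [G] is enough. *)
Lemma inverse_pow4_bound n (z : 'cV[R]_n) (w : 'I_n -> R) (G g L Q c : R) :
  (8 <= n)%N -> 0 < G -> 0 < g -> 1 <= L -> 0 <= Q -> 0 < c ->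
  (forall i, 1 <= w i) -> (forall i, 1 <= w i ^+ 4 * z i ord0 ^+ 2) ->
  (l2norm z ^+ 2) ^+ 4 <= (n%:R * g ^+ 2) ^+ 2 * (L ^+ 2 * Q) * G ^+ 4 ->
  l2norm z ^+ 2 <= n%:R * g ^+ 2 * G ^+ 2 ->
  c = 36 ^- 4 ->
  G ^- 4 <= (c ^- 4 * Q + c ^- 2 * (\prod_(i < n) w i / 9 ^+ n)) * (g ^+ 4 * (L / n%:R) ^+ 2).
Proof.
move=> n8 G0 g0 L1 Q0 c0 w1 wz hQ hG cE.
set S := l2norm z ^+ 2 in hQ hG *; set D := \prod_(i < n) w i.
have N0 : 0 < n%:R :> R by rewrite ltr0n (leq_trans _ n8).
have D1 : 1 <= D by apply: (big_ind (fun x => 1 <= x)) => // x y; exact: mulr_ege1.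
have prodS : \prod_(i < n) z i ord0 ^+ 2 <= (S / n%:R) ^+ n.
  have := @leif_AGM R 'I_n 'I_n (fun i => z i ord0 ^+ 2) (fun i _ => sqr_ge0 _).
  rewrite /= card_ord => -[+ _].
  rewrite /S sqr_l2norm /dot; under [X in _ -> _ <= (X / _) ^+ _]eq_bigr do rewrite -expr2.
  by [].
have prodD : 1 <= D ^+ 4 * (S / n%:R) ^+ n.
  apply: (@le_trans _ _ (D ^+ 4 * \prod_(i < n) z i ord0 ^+ 2)); last first.
    by rewrite ler_wpM2l// exprn_ge0// (le_trans _ D1).
  rewrite /D -prodrXl -big_split.
  by apply: (big_ind (fun x => 1 <= x)) => [//|x y|i _]; [exact: mulr_ege1|exact: wz].
have S_ge0 : 0 <= S by exact: sqr_ge0.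
have S0 : 0 < S.
  rewrite lt0r S_ge0 andbT; apply/eqP => S0; move: prodD.
  by rewrite S0 mul0r expr0n gtn_eqF ?(leq_trans _ n8)// mulr0; lra.
have G4 : 0 < G ^+ 4 by rewrite exprn_gt0.
have rhs1 : 0 <= c ^- 4 * Q by rewrite mulr_ge0// invr_ge0 exprn_ge0// ltW.
have rhs2 : 0 <= c ^- 2 * (D / 9 ^+ n).
  by rewrite mulr_ge0 ?divr_ge0 ?invr_ge0 ?exprn_ge0// ?ltW// (lt_le_trans _ D1).
have L0 : 0 < L by lra.
have gl : 0 < g ^+ 4 * (L / n%:R) ^+ 2 by rewrite mulr_gt0 ?exprn_gt0 ?divr_gt0.
have [cS|cS] := leP (c * n%:R) S.
  rewrite mulrDl -[leLHS]addr0 lerD//; last by rewrite mulr_ge0// ltW.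
  rewrite -div1r ler_pdivrMr//.
  have cn : 0 < c * n%:R by rewrite mulr_gt0.
  have S4 : (c * n%:R) ^+ 4 <= S ^+ 4 by rewrite lerXn2r ?nnegrE// ltW.
  have := le_trans S4 hQ.
  rewrite -[leLHS]mulr1 -ler_pdivlMl ?exprn_gt0// => h; apply: (le_trans h).
  rewrite le_eqVlt; apply/orP; left; apply/eqP.
  by field; rewrite !gt_eqF.
rewrite mulrDl -[leLHS]add0r lerD//; first by rewrite mulr_ge0// ltW.
(* [u] measures how far |z|^2 falls below the threshold c n. *)
pose u := c * n%:R / S.
have u1 : 1 <= u by rewrite ler_pdivlMr// mul1r ltW.
have u0 : 0 <= u by lra.
have cn36 : (c ^+ n) = (36 ^- n) ^+ 4.
  by rewrite cE -!exprVn -!exprM mulnC.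
(* Here n >= 8 and u >= 1 enter. As c = 36^-4, the bound 1 <= D^4 (S / n)^n says that u^n <= (D /
   36^n)^4. *)
have u8 : u ^+ 8 <= (D / 36 ^+ n) ^+ 4.
  apply: (@le_trans _ _ (u ^+ n)); first exact: ler_weXn2l.
  rewrite (@exprMn _ 4 D) -cn36 mulrC.
  have Sn : 0 < (S / n%:R) ^+ n by rewrite exprn_gt0// divr_gt0.
  have -> : u ^+ n = c ^+ n * ((S / n%:R) ^+ n)^-1.
    have -> : u = c * (S / n%:R)^-1 by rewrite /u; field; rewrite !gt_eqF.
    by rewrite (@exprMn _ n c) exprVn.
  rewrite ler_pM2l ?exprn_gt0// -div1r ler_pdivrMr//.
have u2 : u ^+ 2 <= D / 36 ^+ n.
  rewrite -(@ler_pXn2r _ 4)// ?nnegrE ?divr_ge0 ?exprn_ge0// ?(le_trans _ D1)//.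
  by rewrite -exprM.
(* 36 = 4 * 9: the factor 4^n absorbs n^2, and 9^n is left to normalise [D]. *)
have n4 : n%:R ^+ 2 <= 4 ^+ n :> R.
  rewrite -!natrX ler_nat (_ : 4 = 2 ^ 2)%N// -expnM mulnC expnM leq_exp2r//.
  exact: ltnW (ltn_expl _ _).
have key : n%:R ^+ 4 / S ^+ 2 <= c ^- 2 * (D / 9 ^+ n).
  have -> : n%:R ^+ 4 / S ^+ 2 = c ^- 2 * (n%:R ^+ 2 * u ^+ 2).
    by rewrite /u; field; rewrite !gt_eqF.
  rewrite ler_pM2l ?invr_gt0 ?exprn_gt0//.
  apply: (@le_trans _ _ (4 ^+ n * (D / 36 ^+ n))).
    by rewrite ler_pM// sqr_ge0.
  have e36 : 36 ^+ n = 4 ^+ n * 9 ^+ n :> R by rewrite -exprMn; congr (_ ^+ _); ring.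
  rewrite e36 le_eqVlt; apply/orP; left; apply/eqP; field.
  by rewrite !expf_neq0.
apply: (@le_trans _ _ ((n%:R ^+ 4 / S ^+ 2) * (g ^+ 4 * (L / n%:R) ^+ 2))); last first.
  by rewrite ler_wpM2r// ltW.
have hG2 : S ^+ 2 <= (n%:R * g ^+ 2 * G ^+ 2) ^+ 2.
  by rewrite lerXn2r ?nnegrE// !mulr_ge0 ?exprn_ge0// ltW.
rewrite -div1r ler_pdivrMr//.
apply: (@le_trans _ _ (S ^- 2 * (n%:R * g ^+ 2 * G ^+ 2) ^+ 2)).
  have S2 : 0 < S ^+ 2 by rewrite exprn_gt0.
  rewrite -[leLHS](mulVf (lt0r_neq0 S2)); apply: ler_wpM2l hG2.
  by rewrite invr_ge0 ltW.
have -> : n%:R ^+ 4 / S ^+ 2 * (g ^+ 4 * (L / n%:R) ^+ 2) * G ^+ 4 =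
   L ^+ 2 * (S ^- 2 * (n%:R * g ^+ 2 * G ^+ 2) ^+ 2).
  by field; rewrite !gt_eqF.
rewrite ler_peMl// ?exprn_ege1//.
by rewrite mulr_ge0 ?sqr_ge0// invr_ge0 sqr_ge0.
Qed.

(** From |u^2 - 1| <= (u - 1)^2 + 2 |u - 1|; the linear term is handled by 2 |u - 1| <= eta + (u -
    1)^2 / eta, which keeps [W] to the first power. The choice eta = r + sqrt rho makes eta^2
    dominate r^2 + rho. *)
Lemma sqr_error_bound (u k nr r rho V W : R) : 0 <= r -> 0 < rho -> 1 <= W ->
  0 < nr -> 0 <= k <= nr ->
  (u - 1) ^+ 2 <= (r ^+ 2 + rho) * (V * W) -> 0 <= V ->
  k * `|u ^+ 2 - 1| / nr <= (2 * V + 1) * W * (r + r ^+ 2 + Num.sqrt rho + rho).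
Proof.
move=> r0 rho0 W1 nr0 /andP[k0 kn] hv V0.
set q := Num.sqrt rho; have q0 : 0 < q by rewrite sqrtr_gt0.
have q2 : q ^+ 2 = rho by rewrite sqr_sqrtr// ltW.
apply: (@le_trans _ _ `|u ^+ 2 - 1|).
  rewrite mulrAC ler_piMl//; by rewrite ler_pdivrMr// mul1r.
pose eta := r + q; have eta0 : 0 < eta by rewrite /eta; lra.
have h1 : `|u ^+ 2 - 1| <= (u - 1) ^+ 2 + 2 * `|u - 1|.
  have -> : u ^+ 2 - 1 = (u - 1) ^+ 2 + 2 * (u - 1) by ring.
  by apply: le_trans (ler_normD _ _) _; rewrite ger0_norm ?sqr_ge0// normrM (ger0_norm (ler0n R 2)).
have h2 : 2 * `|u - 1| <= eta + eta * (V * W).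
  rewrite -(ler_pM2l eta0).
  have := sqr_ge0 (eta - `|u - 1|); rewrite sqrrB real_normK ?num_real//.
  have : (r ^+ 2 + rho) * (V * W) <= eta ^+ 2 * (V * W).
    rewrite ler_wpM2r ?mulr_ge0//; first lra.
    rewrite /eta sqrrD q2; have : 0 <= r * q by rewrite mulr_ge0// ltW.
    lra.
  rewrite -mulr_natl; nra.
apply: (le_trans h1).
have VW0 : 0 <= V * W by rewrite mulr_ge0//; lra.
have : (r ^+ 2 + rho) * (V * W) + (eta + eta * (V * W)) <= (2 * V + 1) * W * (r + r ^+ 2 + q + rho).
  have p1 : 0 <= eta * (W - 1) by rewrite mulr_ge0//; lra.
  have p2 : 0 <= eta * (V * W) by rewrite mulr_ge0// ltW.
  have p3 : 0 <= (r ^+ 2 + rho) * (V * W) by rewrite mulr_ge0// addr_ge0 ?sqr_ge0// ltW.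
  have p4 : 0 <= (r ^+ 2 + rho) * W by rewrite mulr_ge0 ?addr_ge0 ?sqr_ge0// ?ltW//; lra.
  move: p1 p2 p3 p4; rewrite /eta; lra.
lra.
Qed.

End pointwise_bounds.

(** * The projection onto the column space and the minimality of the estimator *)

Section projection.
Context {R : realType} {n p : nat} (X : 'M[R]_(n, p)).
Local Notation k := (\rank X).

Lemma gram_unitmx m q (B : 'M[R]_(m, q)) : row_free B^T -> B^T *m B \in unitmx.
Proof.
move=> Bfree; rewrite -row_free_unit -kermx_eq0; apply/eqP/row_matrixP => i.
rewrite row0; set v := row i _.
have vG : v *m (B^T *m B) = 0 by apply/sub_kermxP; exact: row_sub.
have Bv0 : B *m v^T = 0.
  apply: dot_eq0.
  have -> : dot (B *m v^T) (B *m v^T) = ((v *m (B^T *m B)) *m v^T) ord0 ord0.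
    rewrite (_ : _ *m v^T = (B *m v^T)^T *m (B *m v^T)); last by rewrite trmx_mul trmxK !mulmxA.
    by rewrite mxE; apply: eq_bigr => j _; rewrite [in RHS]mxE.
  by rewrite vG mul0mx mxE.
have : v *m B^T = 0 by rewrite -[LHS]trmxK trmx_mul trmxK Bv0 trmx0.
by move/eqP; rewrite mulmx_free_eq0// => /eqP.
Qed.

(** The columns of X may be dependent, so the projector is B (B^T B)^-1 B^T for a basis B of the
    column space; its trace is that of an identity matrix of size k. *)
Lemma exists_projector : exists Q : 'M[R]_n,
  [/\ Q^T = Q, Q *m Q = Q, Q *m X = X, exists W, Q = X *m W & \tr Q = k%:R].
Proof.
have [B [C [W [XBC XW Bfree]]]] : exists (B : 'M[R]_(n, k)) (C : 'M[R]_(k, p)) W,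
    [/\ X = B *m C, X *m W = B & row_free B^T].
  have /row_freeP[W rW] : row_free (row_base X) by exact: row_base_free.
  exists (col_base X), (row_base X), W; split; first by rewrite mulmx_base.
    by have := congr1 (mulmx^~ W) (mulmx_base X); rewrite /= -mulmxA rW mulmx1.
  by rewrite /row_free mxrank_tr -/(row_full _) col_base_full.
have Gu := gram_unitmx Bfree.
set G := B^T *m B in Gu.
pose Q := B *m invmx G *m B^T.
have GT : G^T = G by rewrite /G trmx_mul trmxK.
have QB : Q *m B = B by rewrite /Q -mulmxA -/G -mulmxA mulVmx// mulmx1.
exists Q; split.
- by rewrite /Q !trmx_mul trmxK trmx_inv GT mulmxA.
- by rewrite {2}/Q !mulmxA QB.
- have : Q *m (B *m C) = B *m C by rewrite mulmxA QB.
  by rewrite -XBC.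
- by exists (W *m invmx G *m B^T); rewrite !mulmxA XW.
- by rewrite /Q mxtrace_mulC mulmxA -/G mulmxV// mxtrace1.
Qed.

Lemma dot_trmx m (Q : 'M[R]_m) (u v : 'cV[R]_m) : dot (Q *m u) v = dot u (Q^T *m v).
Proof.
rewrite /dot; under eq_bigr => i _ do rewrite mxE mulr_suml.
under [RHS]eq_bigr => i _ do rewrite mxE mulr_sumr.
rewrite exchange_big; apply: eq_bigr => i _; apply: eq_bigr => j _.
by rewrite mxE; ring.
Qed.

Lemma pythagoras_eq0 m (u v : 'cV[R]_m) :
  dot u v = 0 -> dot (u + v) (u + v) <= dot u u -> v = 0.
Proof.
move=> uv; rewrite dotDl !dotDr (dotC v u) uv addr0 add0r gerDl => v0.
by apply: dot_eq0; apply/eqP; rewrite eq_le v0 dot_ge0.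
Qed.

(** Q y is a competitor in the minimization and y - Q y is orthogonal to the column space, so
    Pythagoras forces equality. *)
Lemma is_projectionE (Q : 'M[R]_n) y y' :
  Q^T = Q -> Q *m Q = Q -> Q *m X = X -> (exists W, Q = X *m W) ->
  is_projection X y y' -> y' = Q *m y.
Proof.
move=> QT QQ QX [W QW] [[b _ y'E] ymin].
have := ymin (Q *m y); rewrite QW -mulmxA => /(_ (ex_intro2 _ _ _ I erefl)).
rewrite mulmxA -QW -(@ler_pXn2r _ 2)// ?nnegrE ?l2norm_ge0// !sqr_l2norm.
set u := y - Q *m y; set v := Q *m y - y'.
have -> : y - y' = u + v by rewrite /u /v addrA subrK.
have uv : dot u v = 0.
  have -> : v = Q *m v by rewrite /v mulmxBr mulmxA QQ -y'E mulmxA QX.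
  by rewrite -{1}QT dotC dot_trmx trmxK dotC /u mulmxBr mulmxA QQ subrr -(scale0r 0) dotZl mul0r.
move=> /(pythagoras_eq0 uv)/eqP; rewrite subr_eq0 => /eqP.
by move=> <-.
Qed.

Lemma sqr_l2norm_projector (Q : 'M[R]_n) (x : 'cV[R]_n) : Q^T = Q -> Q *m Q = Q ->
  l2norm (Q *m x) ^+ 2 = \sum_(i < n) \sum_(j < n) Q i j * (x i ord0 * x j ord0).
Proof.
move=> QT QQ; rewrite sqr_l2norm dot_trmx QT mulmxA QQ dotC /dot.
apply: eq_bigr => i _; rewrite mxE mulr_suml; apply: eq_bigr => j _.
ring.
Qed.

(** The sum is the trace of Q Q^T = Q; it turns the variance bound for quadratic forms into one of
    order k. *)
Lemma sum_sqr_projector (Q : 'M[R]_n) : Q^T = Q -> Q *m Q = Q ->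
  \sum_(i < n) \sum_(j < n) Q i j ^+ 2 = \tr Q.
Proof.
move=> QT QQ; rewrite -[in RHS]QQ; apply: eq_bigr => i _.
rewrite mxE; apply: eq_bigr => j _.
by rewrite -[in X in _ = _ * X]QT mxE expr2.
Qed.

Lemma sqr_l2normBZ m (u v : 'cV[R]_m) c :
  l2norm (u - c *: v) ^+ 2 = l2norm u ^+ 2 - 2 * c * dot v u + c ^+ 2 * l2norm v ^+ 2.
Proof.
rewrite !sqr_l2norm !(dotDl, dotDr, dotNl, dotNr, dotZl, dotZr) (dotC u v); ring.
Qed.

(* If [b] has a larger l^1 norm than [b0], moving from [b] towards [b0] leaves
   the feasible set at once: the constraint is active at [b] and its derivative
   in this direction is nonnegative. *)
Lemma prediction_bound (y' e eps : 'cV[R]_n) (b0 b : 'cV[R]_p) (t K : R) :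
  y' = X *m b0 + e -> (forall c, dot (X *m c) e = dot (X *m c) eps) ->
  (forall j, `|dot (col j X) eps| <= K) -> 0 <= K ->
  is_argmin (@l1norm R p) [set b' | l2norm (y' - X *m b') ^+ 2 <= t] b ->
  l2norm (X *m b - X *m b0) ^+ 2 <= `|t - l2norm e ^+ 2| + 4 * (l1norm b0 * K).
Proof.
move=> y'E eeps hK K0 [/= feas bmin].
set m := X *m b - X *m b0.
have mX : m = X *m (b - b0) by rewrite mulmxBr.
(* On the segment from [b] to [b0] the residual is e - (1 - s) m, so the constraint is quadratic in
   [s]. *)
have expand s : l2norm (y' - X *m (b + s *: (b0 - b))) ^+ 2 =
   l2norm e ^+ 2 - 2 * (1 - s) * dot m e + (1 - s) ^+ 2 * l2norm m ^+ 2.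
  have -> : y' - X *m (b + s *: (b0 - b)) = e - (1 - s) *: m.
    rewrite y'E mX mulmxDr -scalemxAr -(opprB b b0) mulmxN scalerBl scale1r mulmxBr.
    by apply/colP => i; rewrite !mxE; ring.
  exact: sqr_l2normBZ.
set P := dot m e in expand; set a := l2norm m ^+ 2 in expand *.
set E := l2norm e ^+ 2 in expand *.
have a0 : 0 <= a by exact: sqr_ge0.
have P_le : P <= l1norm (b - b0) * K.
  rewrite /P mX eeps; apply: le_trans (ler_norm _) _; exact: dot_mulmx_le.
have D_le : E - 2 * P + a <= t.
  by have := expand 0; rewrite scale0r addr0 !subr0 mulr1 expr1n mul1r => <-.
(* In the first case feasibility suffices: a <= t - E + 2 P and P <= 2 |b0|_1 K, whence the constant
   4. *)
have [bb0|b0b] := leP (l1norm b) (l1norm b0).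
  have : l1norm (b - b0) <= 2 * l1norm b0.
    rewrite mulr2n mulrDl mul1r; apply: le_trans (l1normD _ _) _.
    by rewrite -scaleN1r l1normZ normrN1 mul1r lerD2r.
  move=> /(ler_wpM2r K0); have := ler_norm (t - E); lra.
have infeas (s : R) : 0 < s -> s <= 1 -> t < E - 2 * (1 - s) * P + (1 - s) ^+ 2 * a.
  move=> s0 s1; rewrite ltNge; apply/negP => h.
  have := bmin (b + s *: (b0 - b)); rewrite /= expand => /(_ h).
  rewrite leNgt => /negP; apply.
  have -> : b + s *: (b0 - b) = (1 - s) *: b + s *: b0.
    by apply/colP => i; rewrite !mxE; ring.
  apply: le_lt_trans (l1normD _ _) _; rewrite !l1normZ !ger0_norm ?subr_ge0// ?ltW//.
  have : s * l1norm b0 < s * l1norm b by rewrite ltr_pM2l.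
  lra.
(* An explicit small step replaces the limit s -> 0. *)
have small (M d : R) : 0 <= M -> 0 < d -> exists s, [/\ 0 < s, s <= 1 & s * M <= d].
  move=> M0 d0; exists (d / (M + d)).
  have Md : 0 < M + d by lra.
  split; first exact: divr_gt0.
    by rewrite ler_pdivrMr//; lra.
  by rewrite mulrAC ler_pdivrMr// ler_wpM2l//; [exact: ltW|lra].
have D_ge : t <= E - 2 * P + a.
  rewrite leNgt; apply/negP => Dt.
  have [] := small (`|2 * (P - a)| + a) (t - (E - 2 * P + a)).
  - exact: addr_ge0.
  - lra.
  move=> s [s0 s1 sM].
  have := infeas s s0 s1.
  have h1 : s * (2 * (P - a)) <= s * `|2 * (P - a)| by rewrite ler_pM2l// ler_norm.
  have h2 : s * (s * a) <= s * a by rewrite ler_pM2l// ler_piMl.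
  nra.
have Pa : a <= P.
  rewrite leNgt; apply/negP => Pa.
  have [] := small a (a - P) => //; first lra.
  move=> s [s0 s1 sM].
  have := infeas s s0 s1.
  have h2 : s * (s * a) <= s * (a - P) by rewrite ler_pM2l.
  have h3 : 0 < s * (a - P) by rewrite mulr_gt0// subr_gt0.
  nra.
(* Now 2 P - a = E - t and a <= P, so a <= 2 P - a = E - t. *)
have : 0 <= l1norm b0 * K by rewrite mulr_ge0// l1norm_ge0.
have := ler_norm (E - t); rewrite distrC; lra.
Qed.

End projection.

(** * Moments of the error variables *)

Section upper_integral.
Local Open Scope ereal_scope.
Context {R : realType} d (Omega : measurableType d) (P : {measure set Omega -> \bar R}).

(* The dominated function need not be measurable: the integral of a nonnegative
   function is a supremum over the simple functions below it. *)
Lemma ge0_le_integral_nonmeasurable (f g : Omega -> \bar R) :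
  (forall w, 0 <= f w) -> (forall w, f w <= g w) ->
  \int[P]_w f w <= \int[P]_w g w.
Proof.
move=> f0 fg; have g0 w : 0 <= g w := le_trans (f0 w) (fg w).
rewrite !ge0_integralTE//; apply: le_ereal_sup => _ [h hf <-]; exists h => // w.
exact: le_trans (hf w) (fg w).
Qed.

Lemma integralD_le (f g : Omega -> \bar R) (a b : R) :
  measurable_fun setT f -> measurable_fun setT g ->
  (forall w, 0 <= f w) -> (forall w, 0 <= g w) ->
  \int[P]_w f w <= a%:E -> \int[P]_w g w <= b%:E ->
  \int[P]_w (f w + g w) <= (a + b)%:E.
Proof. by move=> mf mg f0 g0 fa gb; rewrite ge0_integralD// EFinD leeD. Qed.

End upper_integral.

Section error_variables.
Context {R : realType} (n p : nat) (X : 'M[R]_(n, p)).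
Hypotheses (n8 : (8 <= n)%N) (p8 : (8 <= p)%N) (X_neq0 : X != 0).
Local Notation N := (@normal_prob R 0 1).
Local Notation T := (measurableTypeR R).
Local Notation P := (prob_power N n).
Local Notation A := (Xtilde X).
Local Notation kappa := (Num.sqrt n%:R * gamma X).
Local Notation L := (ln ((p + n)%N%:R : R)).

Let n_gt0 : (0 < n)%N. Proof. exact: leq_trans n8. Qed.
Let nR_gt0 : 0 < n%:R :> R. Proof. by rewrite ltr0n. Qed.
Let sqrtn_gt0 : 0 < Num.sqrt n%:R :> R. Proof. by rewrite sqrtr_gt0. Qed.
Let g_gt0 : 0 < gamma X. Proof. exact: gamma_gt0. Qed.
Let kappa_gt0 : 0 < kappa. Proof. exact: mulr_gt0. Qed.

Lemma expR_log_dim : expR L = (p + n)%N%:R.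
Proof. by rewrite lnK// posrE ltr0n addn_gt0 n_gt0 orbT. Qed.

(** The bound exp(-1/2) >= 1/2 gives e <= 4, and 4 <= 16 <= p + n. *)
Lemma log_dim_ge1 : 1 <= L.
Proof.
rewrite -ler_expR expR_log_dim.
have h : 2^-1 <= expR (- 2^-1) :> R by apply: le_trans (expR_ge1Dx _); lra.
have e0 := expR_gt0 (2^-1 : R).
have e2 : expR (2^-1) <= 2 :> R by move: h; rewrite expRN lef_pV2 ?posrE.
have -> : expR 1 = expR (2^-1) ^+ 2 :> R by rewrite -expRM_natl; congr expR; field.
apply: (@le_trans _ _ 16%:R); last by rewrite ler_nat (leq_add p8 n8).
nra.
Qed.

Definition cV_of_tuple (t : n.-tuple T) : 'cV[R]_n := \col_i tnth t i.

Lemma cV_of_tupleK (z : 'cV[R]_n) : cV_of_tuple (tuple_of_cV z) = z.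
Proof. by apply/colP => i; rewrite mxE tnth_mktuple. Qed.

(** The factor gamma makes the coordinatewise Lipschitz constant n^(-1/2), independent of X. *)
Definition scaled_norm (t : n.-tuple T) : R := gamma X * atomic_norm X (cV_of_tuple t).

Lemma scaled_norm_lipschitz x y :
  `|scaled_norm x - scaled_norm y| <= (Num.sqrt n%:R)^-1 * \sum_(i < n) `|tnth x i - tnth y i|.
Proof.
rewrite -mulrBr normrM gtr0_norm//.
have := atomic_norm_lipschitz n_gt0 X_neq0 (cV_of_tuple x) (cV_of_tuple y).
move=> /(ler_wpM2l (ltW g_gt0)) /le_trans; apply.
rewrite mulrA invfM mulrCA mulrA -mulrA mulfV ?gt_eqF// mulr1.
rewrite /l1norm; under eq_bigr do rewrite !mxE.
by [].
Qed.

(** Twice the hyperbolic cosine of the deviation from the center [scaled_norm y]; by [pow4_le_cosh]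
    it controls the fourth power of this deviation. *)
Definition cosh_dev (y t : n.-tuple T) : R :=
  expR (scaled_norm t - scaled_norm y) + expR (scaled_norm y - scaled_norm t).

Lemma exists_cosh_dev : exists y, (\int[P]_t (cosh_dev y t)%:E <= (2 * expR 1 + 1)%:E)%E.
Proof.
have c0 : 0 <= (Num.sqrt n%:R)^-1 :> R by rewrite invr_ge0 ltW.
have [y hy] := exists_center c0 scaled_norm_lipschitz.
exists y; move: hy; rewrite exprVn sqr_sqrtr ?ler0n// divff ?gt_eqF//.
Qed.

Lemma measurable_cosh_dev y : measurable_fun setT (cosh_dev y).
Proof.
have c0 : 0 <= (Num.sqrt n%:R)^-1 :> R by rewrite invr_ge0 ltW.
have ms := measurable_coord_lipschitz c0 scaled_norm_lipschitz.
by apply: measurable_funD; apply: measurableT_comp => //; exact: measurable_funB.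
Qed.

(* The columns of [A / kappa] have norm at most one, so each exponential has mean
   at most [expR L = p + n], and there are [2 (p + n)] of them. *)
Definition exp_sum (t : n.-tuple T) : R := (expR (2 * L))^-1 *
  \sum_(j < p + n) (expR (\sum_(i < n) (Num.sqrt L * (A i j / kappa)) * tnth t i) +
                    expR (\sum_(i < n) (- (Num.sqrt L * (A i j / kappa))) * tnth t i)).

Lemma exp_sum_ge0 t : 0 <= exp_sum t.
Proof.
rewrite mulr_ge0 ?invr_ge0 ?expR_ge0//; apply: sumr_ge0 => j _.
by rewrite addr_ge0// expR_ge0.
Qed.

Lemma measurable_exp_sum : measurable_fun setT exp_sum.
Proof.
apply: measurable_funM => //; apply: measurable_sum => j.
by apply: measurable_funD; apply: measurableT_comp => //; exact: measurable_linear.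
Qed.

Lemma integral_exp_sum : (\int[P]_t (exp_sum t)%:E <= 2%:E)%E.
Proof.
have L1 := log_dim_ge1.
have mlin (b : 'I_n -> R) : measurable_fun setT (fun t : n.-tuple T => (expR (\sum_(i < n) b i * tnth t i))%:E).
  by apply/measurable_EFinP/measurableT_comp => //; exact: measurable_linear.
have row_le (j : 'I_(p + n)) : \sum_(i < n) (A i j / kappa) ^+ 2 <= 1.
  have := l2norm_col_Xtilde_le n_gt0 X_neq0 j.
  rewrite -(@ler_pXn2r _ 2)// ?nnegrE ?l2norm_ge0 ?(ltW kappa_gt0)//.
  rewrite sqr_l2norm -[X in _ <= X -> _]mul1r -ler_pdivrMr ?exprn_gt0//; apply: le_trans.
  rewrite /dot mulr_suml; apply: ler_sum => i _.
  by rewrite !mxE exprMn exprVn expr2.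
have mgf_le (s : R) (j : 'I_(p + n)) : s ^+ 2 = L ->
    (\int[P]_t (expR (\sum_(i < n) (s * (A i j / kappa)) * tnth t i))%:E <= (expR L)%:E)%E.
  move=> sL; rewrite gaussian_linear_mgf lee_fin ler_expR.
  under eq_bigr do rewrite exprMn sL.
  rewrite -mulr_sumr; have := row_le j; have : 0 <= L by lra.
  by move=> L0 /(ler_wpM2l L0); lra.
have mterm (j : 'I_(p + n)) : measurable_fun setT (fun t : n.-tuple T =>
    (expR (\sum_(i < n) (Num.sqrt L * (A i j / kappa)) * tnth t i) +
     expR (\sum_(i < n) (- (Num.sqrt L * (A i j / kappa))) * tnth t i))%:E).
  by apply/measurable_EFinP/measurable_funD; apply/measurable_EFinP; exact: mlin.
have sL : Num.sqrt L ^+ 2 = L by rewrite sqr_sqrtr//; lra.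
under eq_integral do rewrite EFinM.
rewrite ge0_integralZl_EFin//; do ?[by rewrite invr_ge0 expR_ge0
  | by move=> t _; rewrite lee_fin; apply: sumr_ge0 => j _; rewrite addr_ge0// expR_ge0
  | by apply/measurable_EFinP; apply: measurable_sum => j;
       apply/measurable_EFinP; exact: mterm].
under eq_integral do rewrite -sumEFin.
rewrite ge0_integral_sum//; do ?[by move=> j t _; rewrite lee_fin addr_ge0// expR_ge0
  | exact: mterm].
apply: (@le_trans _ _ ((expR (2 * L))^-1%:E * \sum_(j < p + n) (2 * expR L)%:E)%E).
  rewrite lee_pmul2l ?lte_fin ?invr_gt0 ?expR_gt0//.
  apply: lee_sum => j _; under eq_integral do rewrite EFinD.
  rewrite mulr2n mulrDl mul1r; apply: integralD_le => //.
  - exact: mgf_le.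
  - under eq_integral do under eq_bigr do rewrite -mulNr.
    by apply: mgf_le; rewrite sqrrN.
rewrite sumEFin -EFinM lee_fin sumr_const card_ord -[(2 * _) *+ (p + n)]mulr_natr.
rewrite -[X in _ * (_ * X)]expR_log_dim -mulrA -expRD (_ : L + L = 2 * L); last by ring.
by rewrite mulrCA mulVf ?mulr1// gt_eqF// expR_gt0.
Qed.

Lemma pow4_dot_bound (z : 'cV[R]_n) j :
  (dot (col j A) z / kappa) ^+ 4 <= L ^+ 2 * (128 + 2048 * exp_sum (tuple_of_cV z)).
Proof.
apply: pow4_max_bound; first exact: log_dim_ge1.
rewrite /exp_sum [leRHS]mulrA mulfV ?mul1r ?gt_eqF ?expR_gt0//.
rewrite (bigD1 j)//= -[leLHS]addr0 lerD//; last first.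
  by apply: sumr_ge0 => i _; rewrite addr_ge0// expR_ge0.
have -> : Num.sqrt L * (dot (col j A) z / kappa) =
    \sum_(i < n) Num.sqrt L * (A i j / kappa) * tnth (tuple_of_cV z) i.
  rewrite /dot mulr_suml mulr_sumr; apply: eq_bigr => i _.
  by rewrite tnth_mktuple !mxE; ring.
rewrite le_eqVlt; apply/orP; left; apply/eqP; congr (_ + expR _).
by rewrite -sumrN; apply: eq_bigr => i _; rewrite mulNr.
Qed.

(** The factor 9^-n, from [integral_sqrt_sing], brings the mean down to at most one. Values are
    extended reals because [sqrt_sing] is infinite at 0. *)
Definition sing_prod (t : n.-tuple T) : \bar R :=
  (9 ^- n)%:E * (\prod_(i < n) sqrt_sing (tnth t i : R))%E.

Lemma sing_prod_ge0 t : (0 <= sing_prod t)%E.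
Proof.
rewrite mule_ge0 ?lee_fin ?invr_ge0 ?exprn_ge0//; apply: prode_ge0 => i *.
exact: le_trans (sqrt_sing_ge1 _).
Qed.

Lemma measurable_sing_prod : measurable_fun setT sing_prod.
Proof.
apply: emeasurable_funM => //.
by apply: (measurable_prod_tnth (h := fun _ => sqrt_sing)) => i; exact: measurable_sqrt_sing.
Qed.

Lemma integral_sing_prod : (\int[P]_t sing_prod t <= 1%:E)%E.
Proof.
have ms := @measurable_sqrt_sing R.
have s0 (t : R) : (0 <= sqrt_sing t)%E by exact: le_trans (sqrt_sing_ge1 _).
have mp : measurable_fun setT (fun t : n.-tuple T => \prod_(i < n) sqrt_sing (tnth t i : R))%E.
  exact: (measurable_prod_tnth (h := fun _ => sqrt_sing)).
rewrite ge0_integralZl_EFin//; last by move=> t _; apply: prode_ge0 => i *.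
rewrite (prob_power_prod N (g := fun _ => sqrt_sing))//.
have I0 : (0 <= \int[N]_t sqrt_sing t)%E by exact: integral_ge0.
have Ifin : (\int[N]_t sqrt_sing t)%E \is a fin_num.
  by rewrite ge0_fin_numE// (le_lt_trans integral_sqrt_sing)// ltry.
have := @integral_sqrt_sing R; rewrite -(fineK Ifin) prodEFin prodr_const card_ord -EFinM !lee_fin.
have := fine_ge0 I0; set I := fine _ => Ige0 I9.
by rewrite mulrC ler_pdivrMr ?exprn_gt0// mul1r lerXn2r// nnegrE.
Qed.

(** For a projector of rank k this is (|Q t|^2 - k)^2 / n, of bounded mean since k <= n. *)
Definition quad_dev (Q : 'M[R]_n) (t : n.-tuple T) : R :=
  (\sum_(i < n) \sum_(j < n) Q i j * (tnth t i * tnth t j) - \sum_(i < n) Q i i) ^+ 2 / n%:R.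

Lemma quad_dev_ge0 Q t : 0 <= quad_dev Q t.
Proof. by rewrite divr_ge0 ?sqr_ge0. Qed.

Lemma measurable_quad_dev Q : measurable_fun setT (quad_dev Q).
Proof.
apply: measurable_funM => //; apply: measurable_funX; apply: measurable_funB => //.
exact: (measurable_quadratic (fun i j => Q i j)).
Qed.

Lemma integral_quad_dev (Q : 'M[R]_n) :
  \sum_(i < n) \sum_(j < n) Q i j ^+ 2 <= n%:R ->
  (\int[P]_t (quad_dev Q t)%:E <= 600%:E)%E.
Proof.
have [k k0 kE] : exists2 k : R, 0 < k & k = 600.
  by exists 600; [rewrite ltr0n|reflexivity].
have := gaussian_quadratic_variance (fun i j => Q i j); rewrite -kE {kE} => gv hQ.
have mq := measurable_quadratic (fun i j => Q i j).
under eq_integral do rewrite /quad_dev mulrC EFinM.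
rewrite ge0_integralZl_EFin; [|exact: measurableT|by move=> t _; rewrite lee_fin sqr_ge0| |by rewrite invr_ge0]; last first.
  by apply/measurable_EFinP/measurable_funX/measurable_funB.
move: gv.
have i0 : (0 < (n%:R^-1)%:E :> \bar R)%E by rewrite lte_fin invr_gt0.
move=> /(lee_wpmul2l (ltW i0)) /le_trans; apply.
rewrite -EFinM lee_fin mulrCA -[leRHS]mulr1 ler_pM2l//.
by rewrite mulrC ler_pdivrMr// mul1r.
Qed.

(** A sum of nonnegative terms dominates each of them; the leading 1 lets constants be absorbed. *)
Definition error_total (Q : 'M[R]_n) y (x z : n.-tuple T) : \bar R :=
  ((1 + cosh_dev y x + cosh_dev y z + exp_sum x + exp_sum z + quad_dev Q x)%:E + sing_prod z)%E.

(** Each factor is at most the product, because the others are at least 1. *)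
Lemma prod_ge1_fin (f : 'I_n -> \bar R) (a : R) : (forall i, 1 <= f i)%E ->
  (\prod_(i < n) f i <= a%:E)%E -> exists w : 'I_n -> R, forall i, f i = (w i)%:E.
Proof.
move=> f1 fa; exists (fun i => fine (f i)) => i; rewrite fineK//.
have f0 j : (0 <= f j)%E by exact: le_trans (f1 j).
rewrite ge0_fin_numE//; apply: le_lt_trans (ltry a); apply: le_trans fa.
rewrite (bigD1 i)//= lee_pemulr//.
by apply: (big_ind (fun x => 1 <= x)%E) => // x y x1 y1; rewrite -[leLHS]mule1 lee_pmul.
Qed.

(** [ratio_sqr_bound] with H at most (c^-4 (128 + 2048) + c^-2) W for c = 36^-4; each 256 is the
    constant of [pow4_le_cosh], once for x and once for z. *)
Definition sigma_const : R :=
  3 / 2 * (1 + 3 * ((36 ^- 4) ^- 4 * (128 + 2048) + (36 ^- 4) ^- 2) + (256 + 256)).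

Lemma sigma_const_ge0 : 0 <= sigma_const.
Proof.
have a0 : 0 <= (36 ^- 4) ^- 4 :> R by rewrite invr_ge0 exprn_ge0 ?invr_ge0 ?exprn_ge0 ?ler0n.
have b0 : 0 <= (36 ^- 4) ^- 2 :> R by rewrite invr_ge0 exprn_ge0 ?invr_ge0 ?exprn_ge0 ?ler0n.
rewrite /sigma_const; move: ((36 ^- 4) ^- 4) ((36 ^- 4) ^- 2) a0 b0 => a b; lra.
Qed.

Lemma sigma_pointwise y (x z : 'cV[R]_n) (M b W : R) : 1 <= W ->
  `|M - atomic_norm X x| <= b ->
  cosh_dev y (tuple_of_cV x) <= W -> cosh_dev y (tuple_of_cV z) <= W ->
  exp_sum (tuple_of_cV z) <= W -> (sing_prod (tuple_of_cV z) <= W%:E)%E ->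
  (M / atomic_norm X z - 1) ^+ 2 <=
    ((b * gamma X) ^+ 2 * (L / n%:R) + L / n%:R) * (sigma_const * W).
Proof.
move=> W1 MF Ux Uz sz Dz; set G := atomic_norm X z.
have L1 := log_dim_ge1.
have rho0 : 0 < L / n%:R by rewrite divr_gt0//; lra.
have nn9 : 0 < 9 ^+ n :> R by rewrite exprn_gt0.
have [w wE] : exists w : 'I_n -> R, forall i, sqrt_sing (z i ord0) = (w i)%:E.
  apply: (@prod_ge1_fin _ (9 ^+ n * W)) => [i|]; first exact: sqrt_sing_ge1.
  rewrite EFinM; apply: le_trans (lee_wpmul2l _ Dz); last by rewrite lee_fin ltW.
  rewrite /sing_prod muleA -EFinM divff ?gt_eqF// mul1e.
  by under [leRHS]eq_bigr do rewrite tnth_mktuple.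
have w1 i : 1 <= w i by rewrite -lee_fin -wE sqrt_sing_ge1.
have wz i : 1 <= w i ^+ 4 * z i ord0 ^+ 2 by exact: sqrt_sing_key.
have DW : \prod_(i < n) w i / 9 ^+ n <= W.
  rewrite -lee_fin mulrC EFinM -prodEFin; apply: le_trans Dz.
  by rewrite /sing_prod; under [X in (_ <= _ * X)%E]eq_bigr do rewrite tnth_mktuple wE.
have crude : l2norm z ^+ 2 <= n%:R * gamma X ^+ 2 * G ^+ 2.
  have G0 : 0 <= G by exact: atomic_norm_ge0.
  have := l2norm_le_atomic n_gt0 X_neq0 z.
  rewrite -(@ler_pXn2r _ 2)// ?nnegrE ?l2norm_ge0 ?mulr_ge0 ?(ltW g_gt0) ?(ltW sqrtn_gt0)//.
  by rewrite !exprMn (sqr_sqrtr (ler0n R n)).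
(* No coordinate of [z] vanishes, as 1 <= w_i^4 z_i^2; this makes the denominator [G] positive. *)
have zi : 0 < l2norm z ^+ 2.
  rewrite lt0r sqr_ge0 andbT sqrf_eq0; apply/eqP => z0.
  have i := Ordinal n_gt0; have := wz i.
  have /dot_eq0 -> : dot z z = 0 by rewrite -sqr_l2norm z0 expr0n.
  by rewrite mxE expr0n mulr0; lra.
have G0 : 0 < G.
  rewrite lt0r atomic_norm_ge0// andbT; apply/eqP => G0.
  by move: (lt_le_trans zi crude); rewrite G0 expr0n mulr0 ltxx.
set q := 128 + 2048 * exp_sum (tuple_of_cV z).
have es0 := exp_sum_ge0 (tuple_of_cV z).
have q0 : 0 <= q by rewrite /q; lra.
have hqW : q <= (128 + 2048) * W by rewrite /q; lra.
have pd j : (dot (col j A) z / kappa) ^+ 4 <= L ^+ 2 * q by exact: pow4_dot_bound.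
clearbody q.
have dual : (l2norm z ^+ 2) ^+ 4 <= (n%:R * gamma X ^+ 2) ^+ 2 * (L ^+ 2 * q) * G ^+ 4.
  (* The fourth root of L^2 q, so that kappa k1 bounds the pairing of [z] with every column. *)
  pose k1 := Num.sqrt (Num.sqrt (L ^+ 2 * q)).
  have lq : 0 <= L ^+ 2 * q by rewrite mulr_ge0// sqr_ge0.
  have k14 : k1 ^+ 4 = L ^+ 2 * q by rewrite exprn4 !sqr_sqrtr ?sqrtr_ge0.
  have hK j : `|dot (col j A) z| <= kappa * k1.
    rewrite mulrC -ler_pdivrMr// -[X in _ / X](gtr0_norm kappa_gt0) -normf_div.
    rewrite -(@ler_pXn2r _ 4)// ?nnegrE ?sqrtr_ge0// k14.
    rewrite (exprn4 `|_|) real_normK ?num_real// -exprn4.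
    exact: pd.
  have := sqr_l2norm_le_atomic n_gt0 X_neq0 hK.
  rewrite -(@ler_pXn2r _ 4)// ?nnegrE ?mulr_ge0 ?sqrtr_ge0 ?sqr_ge0 ?(ltW g_gt0) ?(ltW G0)//.
  rewrite !exprMn k14 => /le_trans; apply.
  rewrite (exprn4 (Num.sqrt n%:R)) (sqr_sqrtr (ler0n R n)).
  by rewrite le_eqVlt; apply/orP; left; apply/eqP; rewrite /G; ring.
have c0 : 0 < 36 ^- 4 :> R by rewrite invr_gt0 exprn_gt0.
have hG := inverse_pow4_bound n8 G0 g_gt0 L1 q0 c0 w1 wz dual crude erefl.
apply: le_trans (ratio_sqr_bound (atomic_norm X (cV_of_tuple y)) G0 g_gt0 rho0 MF hG) _.
apply: ler_wpM2l.
  by apply: addr_ge0; [apply: mulr_ge0; [exact: sqr_ge0|exact: ltW]|exact: ltW].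
have phiE v : gamma X * (atomic_norm X v - atomic_norm X (cV_of_tuple y)) =
    scaled_norm (tuple_of_cV v) - scaled_norm y.
  by rewrite /scaled_norm cV_of_tupleK mulrBr.
have devE v : (gamma X * (atomic_norm X v - atomic_norm X (cV_of_tuple y))) ^+ 4 <=
    256 * cosh_dev y (tuple_of_cV v).
  by rewrite phiE; apply: le_trans (pow4_le_cosh _) _; rewrite opprB /cosh_dev lexx.
have hx := devE x; have hz := devE z.
have a0 : 0 <= (36 ^- 4) ^- 4 :> R by rewrite invr_ge0 exprn_ge0 ?(ltW c0).
have b0 : 0 <= (36 ^- 4) ^- 2 :> R by rewrite invr_ge0 exprn_ge0 ?(ltW c0).
have hq : (36 ^- 4) ^- 4 * q <= (36 ^- 4) ^- 4 * ((128 + 2048) * W).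
  exact: (ler_wpM2l a0).
have hd := ler_wpM2l b0 DW.
move: hx hz hq hd; rewrite /sigma_const -/G.
move: ((36 ^- 4) ^- 4) ((36 ^- 4) ^- 2) a0 b0 => a c' a0 b0.
move: ((gamma X * (atomic_norm X x - _)) ^+ 4) ((gamma X * (G - _)) ^+ 4) => X4 Z4.
move: (\prod_(i < n) w i / 9 ^+ n) => D.
clear - Ux Uz W1 a0 b0 => hx hz hq hd.
lra.
Qed.

End error_variables.

(** * Pointwise bound on the prediction error *)

Section prediction_pointwise.
Context {R : realType} (n p : nat) (X : 'M[R]_(n, p)).
Hypotheses (n8 : (8 <= n)%N) (p8 : (8 <= p)%N) (X_neq0 : X != 0).
Local Notation L := (ln ((p + n)%N%:R : R)).
Local Notation k := ((\rank X)%:R : R).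
Local Notation kappa := (Num.sqrt n%:R * gamma X).

Let n_gt0 : (0 < n)%N. Proof. exact: leq_trans n8. Qed.
Let nR_gt0 : 0 < n%:R :> R. Proof. by rewrite ltr0n. Qed.

(** The part 2 V + 1 comes from [sqr_error_bound], another 1 from the fluctuation of |Q x|^2 about
    k, and the rest from pairing the noise with the columns. *)
Definition prediction_const (V : R) : R := 2 * V + 2 + 4 * (1 + (128 + 2048)).

Lemma prediction_pointwise (Q : 'M[R]_n) (beta0 bh : 'cV[R]_p) (sigma sh V W : R)
    (eps : 'cV[R]_n) (x := sigma^-1 *: eps)
    (r := l1norm beta0 * gamma X / sigma * Num.sqrt (L / n%:R)) :
  0 < sigma -> Q^T = Q -> Q *m Q = Q -> Q *m X = X -> (exists W, Q = X *m W) ->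
  \tr Q = k -> 1 <= W -> 0 <= V ->
  exp_sum X (tuple_of_cV x) <= W -> quad_dev Q (tuple_of_cV x) <= W ->
  (sh / sigma - 1) ^+ 2 <= (r ^+ 2 + L / n%:R) * (V * W) ->
  is_beta_hat X (X *m beta0 + eps) sh bh ->
  l2norm (X *m bh - X *m beta0) ^+ 2 <=
    (n%:R * sigma ^+ 2) * (prediction_const V * W * (r + r ^+ 2 + Num.sqrt (L / n%:R) + L / n%:R)).
Proof.
move=> s0 QT QQ QX QW trQ W1 V0 hs hq hv [y' [projy argb]].
rewrite /prediction_const.
have L1 := log_dim_ge1 n8 p8 (R := R).
have L0 : 0 < L by lra.
have g0 := gamma_gt0 n_gt0 X_neq0.
have sn0 : 0 < Num.sqrt n%:R :> R by rewrite sqrtr_gt0.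
have k0 : 0 < kappa by exact: mulr_gt0.
have rho0 : 0 < L / n%:R by rewrite divr_gt0.
set rho := L / n%:R in r hv rho0 *.
have r0 : 0 <= r by rewrite /r !mulr_ge0 ?l1norm_ge0 ?invr_ge0 ?sqrtr_ge0// ltW.
have epsE : eps = sigma *: x by rewrite /x scalerA divff ?scale1r// gt_eqF.
have y'E : y' = X *m beta0 + Q *m eps.
  by rewrite (is_projectionE QT QQ QX QW projy) mulmxDr mulmxA QX.
pose q := 128 + 2048 * exp_sum X (tuple_of_cV x).
have es0 := exp_sum_ge0 X (tuple_of_cV x).
have q0 : 0 <= q by rewrite /q; lra.
have hqW : q <= (128 + 2048) * W by rewrite /q; lra.
have pd j : (dot (col j (Xtilde X)) x / kappa) ^+ 4 <= L ^+ 2 * q by exact: pow4_dot_bound.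
set c := 128 + 2048 in hqW *; have c0 : 0 <= c by rewrite /c; lra.
clearbody q c.
pose K := sigma * (kappa * (Num.sqrt L * (1 + q))).
have K0 : 0 <= K.
  by rewrite /K !mulr_ge0 ?sqrtr_ge0 ?(ltW s0) ?(ltW g0)//; lra.
have hK j : `|dot (col j X) eps| <= K.
  rewrite epsE dotZr normrM (gtr0_norm s0) /K ler_pM2l//.
  have -> : col j X = col (lshift n j) (Xtilde X) by apply/colP => i; rewrite [RHS]mxE row_mxEl mxE.
  have := le_sqrt_of_pow4 L1 q0 (pd (lshift n j)).
  by rewrite normrM normfV (gtr0_norm k0) ler_pdivrMr// mulrC.
have eeps v : dot (X *m v) (Q *m eps) = dot (X *m v) eps.
  by rewrite -{1}QT -dot_trmx mulmxA QX.
have := prediction_bound y'E eeps hK K0 argb.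
set B := l2norm (X *m bh - X *m beta0) ^+ 2.
pose u := sh / sigma; pose m := l2norm (Q *m x) ^+ 2.
(* In units of sigma^2 the gap is k u^2 - m, with [u] expected near 1 and [m] near k. *)
have -> : k * sh ^+ 2 - l2norm (Q *m eps) ^+ 2 = sigma ^+ 2 * (k * u ^+ 2 - m).
  rewrite epsE -scalemxAr l2normZ exprMn real_normK ?num_real// /u /m.
  by field; rewrite gt_eqF.
rewrite normrM (ger0_norm (sqr_ge0 sigma)) => hB.
have k_le : 0 <= k <= n%:R by rewrite ler0n ler_nat rank_leq_row.
have hu := sqr_error_bound r0 rho0 W1 nR_gt0 k_le hv V0.
set rt := Num.sqrt rho in hu *.
have rt0 : 0 < rt by rewrite sqrtr_gt0.
have rt2 : rt ^+ 2 = rho by rewrite sqr_sqrtr// ltW.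
(* |Q x|^2 deviates from k by order sqrt n at most, and n^(-1/2) <= sqrt rho because L >= 1. *)
have hm : `|m - k| / n%:R <= rt * W.
  rewrite -(@ler_pXn2r _ 2)// ?nnegrE ?divr_ge0 ?mulr_ge0 ?(ltW rt0)//; last lra.
  rewrite !exprMn rt2 real_normK ?num_real// exprVn.
  have : (m - k) ^+ 2 / n%:R <= W.
    move: hq; rewrite /quad_dev /m sqr_l2norm_projector// -trQ.
    under [X in X - _]eq_bigr do under eq_bigr do rewrite !tnth_mktuple.
    by [].
  set dm := (m - k) ^+ 2 => hdm.
  have -> : dm * (n%:R ^+ 2)^-1 = (dm / n%:R) / n%:R by field; rewrite gt_eqF.
  apply: (@le_trans _ _ (W / n%:R)); first by rewrite ler_pM2r ?invr_gt0.
  have invn : n%:R^-1 <= rho by rewrite /rho ler_peMl// invr_ge0.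
  apply: (@le_trans _ _ (W * rho)); first by apply: ler_wpM2l => //; lra.
  rewrite expr2 mulrC ler_pM2l//; apply: ler_peMl => //; lra.
(* The form of [r] originates here: kappa sqrt L = n gamma sqrt(L / n). *)
have hKn : 4 * (l1norm beta0 * K) = (n%:R * sigma ^+ 2) * (4 * r * (1 + q)).
  rewrite /K /r /rho sqrtrM ?(ltW L0)// sqrtrV ?ler0n//.
  have -> : n%:R = Num.sqrt n%:R ^+ 2 :> R by rewrite sqr_sqrtr ?ler0n.
  by rewrite sqrtr_sqr (gtr0_norm sn0); field; rewrite !gt_eqF.
apply: (le_trans hB); rewrite hKn.
have nm : `|k * u ^+ 2 - m| <= k * `|u ^+ 2 - 1| + `|m - k|.
  have -> : k * u ^+ 2 - m = k * (u ^+ 2 - 1) - (m - k) by ring.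
  apply: le_trans (ler_normB _ _) _.
  by rewrite normrM ger0_norm.
have ns0 : 0 < n%:R * sigma ^+ 2 by rewrite mulr_gt0// exprn_gt0.
have -> : sigma ^+ 2 * `|k * u ^+ 2 - m| = (n%:R * sigma ^+ 2) * (`|k * u ^+ 2 - m| / n%:R).
  by field; rewrite gt_eqF.
rewrite -mulrDr ler_pM2l//.
have nm' : `|k * u ^+ 2 - m| / n%:R <= k * `|u ^+ 2 - 1| / n%:R + `|m - k| / n%:R.
  by rewrite -mulrDl ler_pM2r ?invr_gt0.
have r2 := sqr_ge0 r.
set E := r + r ^+ 2 + rt + rho in hu *.
have W0 : 0 < W by lra.
have rE : r <= E by rewrite /E; lra.
have rtE : rt <= E by rewrite /E; lra.
have {}rE : r * (1 + q) <= (1 + c) * W * E.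
  by rewrite mulrC; apply: ler_pM => //; lra.
have {}rtE : rt * W <= E * W by rewrite ler_pM2r.
rewrite (_ : 4 * r * (1 + q) = 4 * (r * (1 + q))); last by rewrite mulrA.
rewrite (_ : (2 * V + 2 + 4 * (1 + c)) * W * E =
  (2 * V + 1) * W * E + E * W + 4 * ((1 + c) * W * E)); last by ring.
clear - nm' hu hm rE rtE; lra.
Qed.

End prediction_pointwise.

(** Bundles the side conditions of additivity of the integral, so that the summands of [error_total]
    are added by chaining one lemma. *)
Definition bounded_mean d (Omega : measurableType d) (R : realType)
    (P : {measure set Omega -> \bar R}) (f : Omega -> \bar R) (a : R) :=
  [/\ measurable_fun setT f, forall w, (0 <= f w)%E & (\int[P]_w f w <= a%:E)%E].

Lemma bounded_meanD d (Omega : measurableType d) (R : realType)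
    (P : {measure set Omega -> \bar R}) (f g : Omega -> \bar R) (a b : R) :
  bounded_mean P f a -> bounded_mean P g b ->
  bounded_mean P (fun w => f w + g w)%E (a + b).
Proof.
move=> [mf f0 fa] [mg g0 gb]; split; first exact: emeasurable_funD.
  by move=> w; rewrite adde_ge0.
exact: integralD_le.
Qed.

(** * The mean of the total error *)

Section error_total.
Context {R : realType} (n p : nat) (X : 'M[R]_(n, p)).
Hypotheses (n8 : (8 <= n)%N) (p8 : (8 <= p)%N) (X_neq0 : X != 0).
Context d (Omega : measurableType d) (P : probability Omega R).
Local Notation T := (measurableTypeR R).

Definition total_const : R := 1 + (2 * expR 1 + 1) + (2 * expR 1 + 1) + 2 + 2 + 600 + 1.

Lemma measurable_error_total (Q : 'M[R]_n) y (x z : Omega -> n.-tuple T) :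
  measurable_fun setT x -> measurable_fun setT z ->
  measurable_fun setT (fun w => error_total X Q y (x w) (z w)).
Proof.
move=> mx mz; apply: emeasurable_funD; last first.
  by apply: measurableT_comp mz; exact: measurable_sing_prod.
have mc := measurable_cosh_dev n8 X_neq0 y; have me := measurable_exp_sum X.
have mq := measurable_quad_dev Q.
apply/measurable_EFinP.
apply: measurable_funD; last exact: measurableT_comp mq mx.
apply: measurable_funD; last exact: measurableT_comp me mz.
apply: measurable_funD; last exact: measurableT_comp me mx.
apply: measurable_funD; last exact: measurableT_comp mc mz.
by apply: measurable_funD => //; exact: measurableT_comp mc mx.
Qed.

Lemma cosh_dev_ge0 y t : 0 <= cosh_dev X y t.
Proof. by rewrite addr_ge0// expR_ge0. Qed.

Lemma error_total_ge1 (Q : 'M[R]_n) y x z : (1 <= error_total X Q y x z)%E.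
Proof.
rewrite /error_total -[leLHS]adde0 leeD// ?sing_prod_ge0// lee_fin.
have := cosh_dev_ge0 y x; have := cosh_dev_ge0 y z.
have := exp_sum_ge0 X x; have := exp_sum_ge0 X z; have := quad_dev_ge0 Q x.
lra.
Qed.

Lemma integral_error_total (Q : 'M[R]_n) (xi zeta : Omega -> 'cV[R]_n) :
  isotropic_gaussian P 1 xi -> isotropic_gaussian P 1 zeta ->
  \sum_(i < n) \sum_(j < n) Q i j ^+ 2 <= n%:R ->
  exists y, (\int[P]_w error_total X Q y (tuple_of_cV (xi w)) (tuple_of_cV (zeta w))
    <= total_const%:E)%E.
Proof.
move=> gx gz hQ; have [y hy] := exists_cosh_dev n8 X_neq0.
exists y.
have mc := measurable_cosh_dev n8 X_neq0 y; have me := measurable_exp_sum X.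
have mq := measurable_quad_dev Q.
have push (V : Omega -> 'cV[R]_n) (f : n.-tuple T -> \bar R) (c : R) :
    isotropic_gaussian P 1 V -> measurable_fun setT f -> (forall t, 0 <= f t)%E ->
    (\int[prob_power (normal_prob 0 1) n]_t f t <= c%:E)%E ->
    bounded_mean P (fun w => f (tuple_of_cV (V w))) c.
  move=> gV mf f0 fc; split; last by rewrite (integral_gaussian_vector gV mf f0).
    exact: measurableT_comp mf (measurable_tuple_of_cV gV).
  by move=> w; exact: f0.
have pushR (V : Omega -> 'cV[R]_n) (f : n.-tuple T -> R) (c : R) :
    isotropic_gaussian P 1 V -> measurable_fun setT f -> (forall t, 0 <= f t) ->
    (\int[prob_power (normal_prob 0 1) n]_t (f t)%:E <= c%:E)%E ->
    bounded_mean P (fun w => (f (tuple_of_cV (V w)))%:E) c.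
  by move=> gV mf f0; apply: (push V (fun t => (f t)%:E)) => //; exact/measurable_EFinP.
have c0 := cosh_dev_ge0 y; have e0 := exp_sum_ge0 X; have q0 := quad_dev_ge0 Q.
have b1 : bounded_mean P (fun=> 1%:E) 1.
  by split; [exact: measurable_cst| |rewrite integral_cst//= probability_setT mule1].
have b2 := pushR _ _ _ gx mc c0 hy.
have b3 := pushR _ _ _ gz mc c0 hy.
have b4 := pushR _ _ _ gx me e0 (integral_exp_sum n8 p8 X_neq0).
have b5 := pushR _ _ _ gz me e0 (integral_exp_sum n8 p8 X_neq0).
have b6 := pushR _ _ _ gx mq q0 (integral_quad_dev n8 hQ).
have b7 := push _ _ _ gz (@measurable_sing_prod R n) (@sing_prod_ge0 R n) (@integral_sing_prod R n).
have [_ _] := bounded_meanD (bounded_meanD (bounded_meanD (bounded_meanD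
  (bounded_meanD (bounded_meanD b1 b2) b3) b4) b5) b6) b7.
rewrite /error_total /total_const.
by under [X in _ -> (X <= _)%E]eq_integral do rewrite !EFinD.
Qed.

End error_total.

Section pointwise_total.
Context {R : realType} (n p : nat) (X : 'M[R]_(n, p)).
Hypotheses (n8 : (8 <= n)%N) (p8 : (8 <= p)%N) (X_neq0 : X != 0).
Local Notation L := (ln ((p + n)%N%:R : R)).

Lemma error_total_le (Q : 'M[R]_n) y x z (W : R) : (error_total X Q y x z <= W%:E)%E ->
  [/\ 1 <= W, cosh_dev X y x <= W, cosh_dev X y z <= W & exp_sum X x <= W] /\
  [/\ exp_sum X z <= W, quad_dev Q x <= W & (sing_prod z <= W%:E)%E].
Proof.
have c0 := cosh_dev_ge0 X y x; have c1 := cosh_dev_ge0 X y z.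
have e0 := exp_sum_ge0 X x; have e1 := exp_sum_ge0 X z; have q0 := quad_dev_ge0 Q x.
have s0 := sing_prod_ge0 z.
rewrite /error_total; set a := 1 + _ + _ + _ + _ + _ => hW.
have aW : a <= W by rewrite -lee_fin (le_trans _ hW)// leeDl.
have a0 : 0 <= a by rewrite /a; lra.
split; split; try (by apply: le_trans aW; rewrite /a; lra).
by rewrite (le_trans _ hW)// leeDr.
Qed.

(** By homogeneity sh / sigma is f(X beta0 / sigma + eps / sigma) / f(z), whose numerator is within
    |beta0|_1 / sigma of f(eps / sigma); this distance times gamma sqrt(L / n) is [r]. *)
Lemma sigma_hat_pointwise (Q : 'M[R]_n) y (beta0 : 'cV[R]_p) (eps z : 'cV[R]_n) (sigma sh W : R)
    (r := l1norm beta0 * gamma X / sigma * Num.sqrt (L / n%:R)) :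
  0 < sigma -> is_sigma_hat X (X *m beta0 + eps) z sh ->
  (error_total X Q y (tuple_of_cV (sigma^-1 *: eps)) (tuple_of_cV z) <= W%:E)%E ->
  (sh / sigma - 1) ^+ 2 <= (r ^+ 2 + L / n%:R) * (sigma_const * W).
Proof.
move=> s0 [M1 [M2 [hM1 hM2 ->]]] /error_total_le[[W1 cx cz _] [ez _ sz]].
have n0 : (0 < n)%N by exact: leq_trans n8.
have L1 := log_dim_ge1 n8 p8 (R := R).
rewrite (is_min_l1_atomic n0 X_neq0 hM1) (is_min_l1_atomic n0 X_neq0 hM2) mulrAC.
rewrite [X in X / _ - 1]mulrC -(atomic_normZ n0 X_neq0) ?invr_gt0// scalerDr scalemxAr.
have MF : `|atomic_norm X (X *m (sigma^-1 *: beta0) + sigma^-1 *: eps)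
    - atomic_norm X (sigma^-1 *: eps)| <= l1norm beta0 / sigma.
  rewrite [X *m _ + _]addrC -Xtilde_col_mx0; apply: le_trans (atomic_normB_le n0 X_neq0 _ _) _.
  rewrite l1norm_col_mx l1normZ gtr0_norm ?invr_gt0// mulrC.
  have -> : l1norm (0 : 'cV[R]_n) = 0 by rewrite /l1norm big1// => i _; rewrite mxE normr0.
  by rewrite addr0.
have := sigma_pointwise n8 p8 X_neq0 W1 MF cx cz ez sz.
have -> // : (l1norm beta0 / sigma * gamma X) ^+ 2 * (L / n%:R) = r ^+ 2.
rewrite /r (@exprMn _ 2 _ (Num.sqrt _)) sqr_sqrtr; last by rewrite divr_ge0 ?ler0n//; lra.
by congr (_ ^+ 2 * _); rewrite mulrAC.
Qed.

End pointwise_total.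

(** The pointwise bound is available only where [g] is finite; elsewhere a g is infinite because a >
    0. *)
Lemma expectation_le_scaled d (Omega : measurableType d) (R : realType)
    (P : probability Omega R) (f : Omega -> R) (g : Omega -> \bar R) (a c : R) :
  0 < a -> (forall w, 0 <= f w) -> measurable_fun setT g -> (forall w, 1 <= g w)%E ->
  (\int[P]_w g w <= c%:E)%E ->
  (forall w W, g w = W%:E -> f w <= a * W) ->
  ('E_P[f] <= (a * c)%:E)%E.
Proof.
move=> a0 f0 mg g1 gc fg; rewrite unlock.
have g0 w : (0 <= g w)%E := le_trans lee01 (g1 w).
apply: (@le_trans _ _ (\int[P]_w (a%:E * g w)))%E.
  apply: ge0_le_integral_nonmeasurable => w; first by rewrite lee_fin.
  case gw : (g w) => [W| |]; first by rewrite -EFinM lee_fin fg.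
    by rewrite gt0_muley ?leey// lte_fin.
  by have := g1 w; rewrite gw.
rewrite ge0_integralZl_EFin//; last exact: ltW.
by rewrite EFinM lee_pmul2l// lte_fin.
Qed.

Theorem theorem2p1 (R : realType) :
  exists C : R,
  forall (n p : nat) (hn : (8 <= n)%N) (hp : (8 <= p)%N)
    (X : 'M[R]_(n, p)) (hX : X != 0)
    (beta0 : 'cV[R]_p) (sigma : R) (hsigma : 0 < sigma)
    (d : measure_display) (Omega : measurableType d) (P : probability Omega R)
    (eps Y Z : Omega -> 'cV[R]_n)
    (heps : isotropic_gaussian P sigma eps)
    (hY : forall w, Y w = X *m beta0 + eps w)
    (hZ : isotropic_gaussian P 1 Z)
    (hZY : independent_vectors P Z Y)
    (sigmahat : Omega -> R) (betahat : Omega -> 'cV[R]_p)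
    (hsigmahat : forall w, is_sigma_hat X (Y w) (Z w) (sigmahat w))
    (hbetahat : forall w, is_beta_hat X (Y w) (sigmahat w) (betahat w)),
  let L : R := ln ((p + n)%N%:R) in
  let r : R := l1norm beta0 * gamma X / sigma * Num.sqrt (L / n%:R) in
  ('E_P[fun w => (l2norm (X *m betahat w - X *m beta0) ^+ 2)%R]
     / (n%:R * sigma ^+ 2)%R%:E
   <= (C * r + C * r ^+ 2 + C * Num.sqrt (L / n%:R) + C * L / n%:R)%R%:E)%E
  /\
  ('E_P[fun w => ((sigmahat w / sigma - 1) ^+ 2)%R]
   <= (C * r ^+ 2 + C * L / n%:R)%R%:E)%E.
Proof.
have V0 : 0 <= sigma_const :> R by exact: sigma_const_ge0.
have c0 : 0 <= total_const :> R.
  by have := expR_ge0 (1 : R); rewrite /total_const; lra.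
have K0 : 0 < prediction_const sigma_const :> R by rewrite /prediction_const; lra.
(* The sum of the two pointwise constants dominates each, so one C serves both inequalities. *)
exists ((prediction_const sigma_const + sigma_const) * total_const).
move=> n p n8 p8 X X_neq0 beta0 sigma s0 d Omega P eps Y Z geps hY gZ _ sh bh hsh hbh L r.
have n0 : (0 < n)%N by exact: leq_trans n8.
have nR0 : 0 < n%:R :> R by rewrite ltr0n.
have L1 : 1 <= L by exact: log_dim_ge1.
have rho0 : 0 < L / n%:R by rewrite divr_gt0//; lra.
have r0 : 0 <= r.
  by rewrite /r !mulr_ge0 ?l1norm_ge0 ?invr_ge0 ?sqrtr_ge0// ltW// gamma_gt0.
have [Q [QT QQ QX QW trQ]] := exists_projector X.
have hQ : \sum_(i < n) \sum_(j < n) Q i j ^+ 2 <= n%:R.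
  by rewrite sum_sqr_projector// trQ ler_nat rank_leq_row.
have gx := isotropic_gaussian_scale s0 geps.
have [y hy] := integral_error_total n8 p8 X_neq0 gx gZ hQ.
have mW := measurable_error_total n8 X_neq0 Q y
  (measurable_tuple_of_cV gx) (measurable_tuple_of_cV gZ).
have W1 w := error_total_ge1 X Q y (tuple_of_cV (sigma^-1 *: eps w)) (tuple_of_cV (Z w)).
have hv w W : error_total X Q y (tuple_of_cV (sigma^-1 *: eps w)) (tuple_of_cV (Z w)) = W%:E ->
    (sh w / sigma - 1) ^+ 2 <= (r ^+ 2 + L / n%:R) * (sigma_const * W).
  move=> wW; have := hsh w; rewrite hY => hs.
  by apply: (sigma_hat_pointwise (Q := Q) (y := y) n8 p8 X_neq0 s0 hs); rewrite wW.
have hp w W : error_total X Q y (tuple_of_cV (sigma^-1 *: eps w)) (tuple_of_cV (Z w)) = W%:E ->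
    l2norm (X *m bh w - X *m beta0) ^+ 2 <= (n%:R * sigma ^+ 2) *
      (prediction_const sigma_const * W * (r + r ^+ 2 + Num.sqrt (L / n%:R) + L / n%:R)).
  move=> wW; have hs := hv w W wW; have := hbh w; rewrite hY => hb.
  have /error_total_le[[hW1 _ _ ex] [_ qx _]] :
    (error_total X Q y (tuple_of_cV (sigma^-1 *: eps w)) (tuple_of_cV (Z w)) <= W%:E)%E by rewrite wW.
  exact: (prediction_pointwise n8 p8 X_neq0 s0 QT QQ QX QW trQ hW1 V0 ex qx hs hb).
set Kp := prediction_const _ in K0 hp *; set V := sigma_const in V0 hv *.
set c := total_const in c0 hy *.
set E := r + r ^+ 2 + _ + _ in hp.
have E0 : 0 < E.
  by rewrite /E; have := sqr_ge0 r; have := sqrtr_ge0 (L / n%:R); lra.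
have ns0 : 0 < n%:R * sigma ^+ 2 by rewrite mulr_gt0// exprn_gt0.
have kv w W : error_total X Q y (tuple_of_cV (sigma^-1 *: eps w)) (tuple_of_cV (Z w)) = W%:E -> 0 <= W.
  by move=> wW; rewrite -lee_fin -wW (le_trans _ (W1 w)).
have KV0 : 0 < Kp + V by lra.
split; last first.
  rewrite (_ : _ + _ = (r ^+ 2 + L / n%:R) * (Kp + V) * c); last by ring.
  apply: (expectation_le_scaled _ _ mW W1 hy) => [|w|w W wW]; last 1 first.
  - apply: le_trans (hv w W wW) _; rewrite -mulrA; apply: ler_wpM2l.
      by have := sqr_ge0 r; lra.
    by apply: ler_wpM2r; [exact: kv wW|lra].
  - by rewrite mulr_gt0//; have := sqr_ge0 r; lra.
  - exact: sqr_ge0.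
rewrite inver gt_eqF// lee_pdivrMr//.
rewrite -EFinM [X in (_ <= X%:E)%E](_ : _ = (n%:R * sigma ^+ 2) * ((Kp + V) * E) * c); last by rewrite /E; ring.
apply: (expectation_le_scaled _ _ mW W1 hy) => [|w|w W wW]; last 1 first.
- apply: le_trans (hp w W wW) _.
  rewrite -[leRHS]mulrA ler_pM2l// [leRHS]mulrAC ler_pM2r//.
  by apply: ler_wpM2r; [exact: kv wW|lra].
- by rewrite !mulr_gt0.
- exact: sqr_ge0.
Qed.
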